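(* Let $\kappa$ be a transformation of $\mathbb{R}\setminus\mathbb{Q}$ induced by an element of the Thompson group $\mathrm{Th}$, and let $\Xi:\mathbb{R}\setminus\mathbb{Q}\to\partial\mathbb{T}$ be the continued-fraction bijection. Then the transformation $\Xi\circ\kappa\circ\Xi^{-1}$ of $\partial\mathbb{T}$ is contained in $\mathrm{Hier}(\mathbb{T})$, i.e. it is the boundary map of a spheromorphism of $\mathbb{T}$.
   Context: $\mathbb{N}=\{1,2,\dots\}$. $\mathbb{T}$ is the tree (unique up to isomorphism) in which every vertex has countably infinite valence. A way in a tree is a (here infinite) sequence of pairwise distinct vertices $a_0,a_1,a_2,\dots$ with $a_j,a_{j+1}$ joined by an edge; two ways $a,b$ are equivalent if there is $k\in\mathbb{Z}$ with $b_j=a_{j+k}$ for all large $j$. The boundary $\partial\mathbb{T}$ is the set of equivalence classes of ways. Spheromorphisms: a subtree $S\subset\mathbb{T}$ isomorphic to $\mathbb{T}$ is a $(\mathbb{T})$-subtree if only finitely many edges $[a,b]$ of $\mathbb{T}$ satisfy $a\in S$, $b\notin S$. A $(\mathbb{T})$-covering forest is a finite collection of pairwise disjoint $(\mathbb{T})$-subtrees obtained from $\mathbb{T}$ by removing a finite (possibly empty) set of edges, keeping all vertices. A spheromorphism $g$ is given by two $(\mathbb{T})$-covering forests $S_1,\dots,S_k$ and $R_1,\dots,R_k$ and tree isomorphisms $g^{(j)}:S_j\to R_j$. It induces a permutation of $\mathrm{vert}(\mathbb{T})$ and a bijection (homeomorphism) of $\partial\mathbb{T}$; these determine one another, and spheromorphisms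 are identified if these maps coincide. $\mathrm{Hier}(\mathbb{T})$ is the group of all spheromorphisms, regarded here as a group of transformations of $\partial\mathbb{T}$. The map $\Xi$: for $y_1<y_2$ in $\mathbb{Q}\cup\{\pm\infty\}$ put $(\!(y_1,y_2)\!):=(y_1,y_2)\setminus\mathbb{Q}$. Split $\mathbb{R}\setminus\mathbb{Q}$ into $(\!(-\infty,-1)\!)$, $(\!(-1,0)\!)$, $(\!(0,1)\!)$, $(\!(1,\infty)\!)$ and write points as continued fractions, respectively, $x=-[s_0;s_1,s_2,\dots]$, $x=-[0;s_1,s_2,\dots]$, $x=[0;s_1,s_2,\dots]$, $x=[s_0;s_1,s_2,\dots]$ with all $s_j\in\mathbb{N}$. For each of the four pieces take a copy of the tree whose vertices are finite (possibly empty) sequences of elements of $\mathbb{N}$ and whose edges join a sequence to each of its one-term extensions; the initial point is the empty sequence. The infinite sequence $(s_1,s_2,\dots)$ (resp. $(s_0,s_1,\dots)$) of partial quotients of $x$ gives a boundary point of the corresponding copy. Add 3 edges connecting the four initial points so that the result is one tree; it is isomorphic to $\mathbb{T}$ and is taken as $\mathbb{T}$. This gives the bijection $\Xi:\mathbb{R}\setminus\mathbb{Q}\to\partial\mathbb{T}$. The Thompson group $\mathrm{Th}$: the group of all homeomorphisms of $\mathbb{RP}^1=\mathbb{R}\cup\{\infty\}$ for which $\mathbb{RP}^1$ can be cut into finitely many segments with endpoints in $\mathbb{Q}\cup\{\infty\}$ such that on each segment the map coincides with a transformation $x\mapsto\frac{ax+b}{cx+d}$ with $a,b,c,d\in\mathbb{Z}$,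 $ad-bc=1$. Such maps preserve $\mathbb{R}\setminus\mathbb{Q}$. *)

(* Defs.v *)
From HB Require Import structures.
From mathcomp Require Import all_boot all_order all_algebra.
From mathcomp Require Import all_classical all_reals all_analysis.

Set Implicit Arguments.
Unset Strict Implicit.
Unset Printing Implicit Defensive.

Import Order.TTheory GRing.Theory Num.Theory.
Import numFieldNormedType.Exports.

Local Open Scope classical_set_scope.
Local Open Scope ring_scope.

(** * Ways, boundary and spheromorphisms of a tree

    A tree is given by its vertex type [V] and its adjacency relation [e];
    subtrees are given by their vertex sets, with the induced edges. *)

Section Spheromorphisms.
Variables (V : Type) (e : V -> V -> Prop).

Definition is_way (a : nat -> V) : Prop :=
  injective a /\ forall j, e (a j) (a j.+1).

Definition way := {a : nat -> V | is_way a}.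

Definition way_fun (a : way) : nat -> V := proj1_sig a.
Coercion way_fun : way >-> Funclass.

(* For large [j] the integer [j + k] is nonnegative, hence equal to its
   absolute value [absz]. *)
Definition way_equiv (a b : way) : Prop :=
  exists k : int, \forall j \near \oo, b j = a (absz (j%:Z + k)).

Definition way_class (a : way) : set way := [set b | way_equiv a b].

Definition boundary := set_type (range way_class).

Definition boundary_point (a : way) : boundary :=
  SigSub (mem_set (imageT way_class a)).

(* [V], [e] plays the role of the tree T itself. *)
Definition T_subtree (S : set V) : Prop :=
  (exists phi : V -> V, [/\ injective phi, range phi = S &
     forall x y, e x y <-> e (phi x) (phi y)]) /\
  finite_set [set xy : V * V | [/\ e xy.1 xy.2, S xy.1 & ~ S xy.2]].

(* The last clause says that the disjoint union of the trees [S j] is the graph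
   obtained from the whole tree by deleting the edges in the finite set [F]. *)
Definition covering_forest (k : nat) (S : 'I_k -> set V) : Prop :=
  [/\ forall j, T_subtree (S j),
      trivIset setT S,
      \bigcup_j S j = setT &
      exists2 F : set (V * V), finite_set F &
        forall x y, (exists j, [/\ S j x, S j y & e x y]) <->
                    [/\ e x y, ~ F (x, y) & ~ F (y, x)]].

Definition subtree_iso (S Q : set V) (g : V -> V) : Prop :=
  set_bij S Q g /\ forall x y, S x -> S y -> (e x y <-> e (g x) (g y)).

(* As the [S j] partition the vertices, the isomorphisms from [S j] to [Q j] are
   the restrictions of a single map [g], the induced permutation of vertices. *)
Definition spheromorphism (g : V -> V) : Prop :=
  exists k (S Q : 'I_k -> set V),
    [/\ covering_forest S, covering_forest Q &
        forall j, subtree_iso (S j) (Q j) g].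

(* A way eventually stays in one tree of the forest, so that [g] maps some tail
   of it to a way. *)
Definition boundary_map (g : V -> V) (h : boundary -> boundary) : Prop :=
  forall a : way, exists N (b : way),
    (forall j, b j = g (a (j + N)%N)) /\
    h (boundary_point a) = boundary_point b.

Definition Hier : set (boundary -> boundary) :=
  [set h | exists2 g, spheromorphism g & boundary_map g h].

End Spheromorphisms.

(** * The tree of continued fractions *)

Definition posnat := {n : nat | (0 < n)%N}.

(* The four pieces of the set of irrationals: the piece of [x] is
   [(x < 0, 1 < `|x|)]. *)
Definition piece := (bool * bool)%type.

Definition vertex := (piece * seq posnat)%type.

Definition child (u v : seq posnat) : Prop := exists s, v = rcons u s.

(* [c] is the graph joining the initial points of the four copies. *)
Definition edge (c : rel piece) (x y : vertex) : Prop :=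
  (x.1 = y.1 /\ (child x.2 y.2 \/ child y.2 x.2)) \/
  [/\ x.2 = [::], y.2 = [::] & c x.1 y.1].

(* A choice of 3 edges making the four initial points into a tree; each edge is
   counted twice, as an ordered pair. *)
Definition connecting_edges (c : rel piece) : Prop :=
  [/\ symmetric c, irreflexive c,
      #|[set pq : piece * piece | c pq.1 pq.2]%SET| = (2 * 3)%N &
      forall p q, connect c p q].

Definition prefix_way (p : piece) (s : nat -> posnat) (n : nat) : vertex :=
  (p, mkseq s n).

Lemma prefix_way_is_way c p s : is_way (edge c) (prefix_way p s).
Proof.
split=> [m n [/(congr1 size)]|j]; first by rewrite !size_mkseq.
left; split=> //; left; exists (s j).
by rewrite /= /mkseq -addn1 iotaD map_cat cats1.
Qed.

Definition seq_way c p s : way (edge c) :=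
  exist _ _ (prefix_way_is_way c p s).

Section Xi.
Variable R : realType.

Definition irr := set_type (@irrational R).

Lemma pi_in_irrational : (pi : R) \in @irrational R.
Proof. by apply/mem_set; exact: pi_irrationnal. Qed.

HB.instance Definition _ := Choice.on irr.
HB.instance Definition _ := isPointed.Build irr (SigSub pi_in_irrational).

(* [convergent n a] is the finite continued fraction [a 0; a 1, ..., a n]. *)
Fixpoint convergent (n : nat) (a : nat -> nat) : R :=
  if n is m.+1 then (a 0)%:R + (convergent m (fun i => a i.+1))^-1
  else (a 0)%:R.

(* [x = [a 0; a 1, a 2, ...]] *)
Definition is_cfrac (x : R) (a : nat -> nat) : Prop :=
  convergent^~ a @ \oo --> x.

Definition piece_of (x : R) : piece := (x < 0, 1 < `|x|).

(* The terms of [`|x|]: the leading [0] is not part of the boundary sequence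
   when [`|x| < 1]. *)
Definition cfrac_terms (p : piece) (s : nat -> posnat) (n : nat) : nat :=
  if p.2 then val (s n) else if n is m.+1 then val (s m) else 0%N.

Definition partial_quotients (x : R) : nat -> posnat :=
  xget (fun=> Sub 1%N isT)
       [set s | is_cfrac `|x| (cfrac_terms (piece_of x) s)].

Definition Xi (c : rel piece) (x : irr) : boundary (edge c) :=
  boundary_point (seq_way c (piece_of (val x)) (partial_quotients (val x))).

(** * The Thompson group *)

Definition RP1 := one_point_compactification R.

(* The image of a point under [x |-> (a x + b) / (c x + d)]. *)
Definition moebius (a b c d : int) (x : RP1) : RP1 :=
  if x is Some r then
    if c%:~R * r + d%:~R == 0 then None
    else Some ((a%:~R * r + b%:~R) / (c%:~R * r + d%:~R))
  else if c == 0 then None else Some (a%:~R / c%:~R).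

(* The points met strictly between [a] and [b] when moving from [a] to [b] in
   the increasing direction of the circle; for [a = b] this is the circle minus
   one point. *)
Definition open_arc (a b : RP1) : set RP1 := [set x |
  match a, b, x with
  | Some a, Some b, Some x => if a < b then a < x < b else (a < x) || (x < b)
  | Some a, Some b, None => b <= a
  | Some a, None, Some x => a < x
  | None, Some b, Some x => x < b
  | None, None, Some _ => true
  | _, _, None => false
  end].

Definition closed_arc (a b : RP1) : set RP1 := open_arc a b `|` [set a; b].

Definition homeomorphism (T U : topologicalType) (f : T -> U) : Prop :=
  continuous f /\
  exists g : U -> T, [/\ cancel f g, cancel g f & continuous g].

(* [C] is the set of points at which the circle is cut. *)
Definition Thompson : set (RP1 -> RP1) := [set f |
  homeomorphism f /\
  exists C : set RP1,
    [/\ finite_set C, C !=set0,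
        C `<=` [set None] `|` Some @` @rational R &
        forall p q, C p -> C q -> C `&` open_arc p q = set0 ->
          exists a b c d : int, a * d - b * c = 1 /\
            forall x, closed_arc p q x -> f x = moebius a b c d x]].

Definition induces (f : RP1 -> RP1) (kappa : irr -> irr) : Prop :=
  forall x : irr, f (Some (val x)) = Some (val (kappa x)).

End Xi.

(* Main.v *)
Require Import Defs.
From mathcomp Require Import all_boot all_order all_algebra.
From mathcomp Require Import all_classical all_reals all_analysis.
From mathcomp Require Import zify ring lra.

(** Vertices of the tree correspond to one-sided germs [(q, eps)] of the circle
    at rational points [q]: the children of a vertex accumulate at [q] from one
    side.  An edge inside one of the four copies joins the two inward germs at
    the end points of an arc between Farey neighbours (determinant 1) that
    contains none of the corners [oo, -1, 0, 1] in its interior, and every such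
    arc occurs.  A piecewise PSL(2,Z) homeomorphism [f] acts on one-sided germs,
    hence permutes the vertices.  It maps an edge to an edge unless a break
    point of [f], or a preimage of a corner, lies inside the arc; a given
    rational point lies inside finitely many arcs, because its numerator and
    denominator bound those of the end points.  As the same holds for the
    inverse of [f], the permutation preserves adjacency up to finitely many
    edges, and cutting the tree at all end points of these edges gives a
    spheromorphism.  The boundary map is the right one since the points [q]
    along a way converge to the irrational number that the way encodes, and [f]
    is continuous. *)

Set Implicit Arguments.
Unset Strict Implicit.
Unset Printing Implicit Defensive.

Import Order.TTheory GRing.Theory Num.Theory.
Import numFieldNormedType.Exports.

Local Open Scope classical_set_scope.

(** * Trees up to finitely many edges *)

Lemma infinite_countable_enum (T : choiceType) (A : set T) :
  countable A -> infinite_set A ->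
  exists h : nat -> T, injective h /\ range h = A.
Proof.
move=> cA iA.
have /card_eqP/unsquash f := card_esym (eq_card_nat cA iA).
exists (fun n => set_val (f (to_setT n))); split=> [m n /val_inj E|].
  by have /(congr1 set_val) := 'inj_f (in_setT _) (in_setT _) E.
rewrite eqEsubset; split=> [_ [n _ <-]|x Ax]; first exact: set_valP.
have [y _ yx] := 'surj_f (I : [set: A] (SigSub (mem_set Ax))).
have -> : x = set_val (f y) by rewrite yx.
by exists (set_val y) => //; congr (set_val (f _)); exact: val_inj.
Qed.

Section RootedTrees.
Variable V : countType.
Variables (r : V) (par : V -> V) (D : set V) (rk : V -> nat).
Hypothesis Dr : D r.
Hypothesis Dpar : forall v, D v -> v <> r -> D (par v) /\ (rk (par v) < rk v)%N.
Hypothesis Dch : forall v, D v ->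
  infinite_set [set w | [/\ D w, w <> r & par w = v]].

(** Enumerating the infinitely many children of every vertex labels the vertices of [D] by finite
    sequences, so any two rooted trees of this kind are isomorphic. The rank makes the climb to [r]
    finite, which gives surjectivity. *)
Lemma rooted_tree_iso : exists th : seq nat -> V,
  [/\ injective th, range th = D &
      forall u v, (th v <> r /\ par (th v) = th u) <-> exists n, v = rcons u n].
Proof.
have /choice[ch chP] : forall v, exists h : nat -> V, D v ->
    injective h /\ range h = [set w | [/\ D w, w <> r & par w = v]].
  move=> v; have [Dv|nDv] := pselect (D v); last by exists (fun=> v).
  have [//|h hP] := infinite_countable_enum _ (Dch Dv); last by exists h.
  exact: countableP.
pose th u := foldl ch r u.
have thr u n : th (rcons u n) = ch (th u) n by rewrite /th -cats1 foldl_cat.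
have Dth u : D (th u).
  elim/last_ind: u => [//|u n IH]; rewrite thr.
  have [_ /seteqP[+ _]] := chP _ IH.
  by move=> /(_ (ch (th u) n)); case; first by exists n.
have thS u n : th (rcons u n) <> r /\ par (th (rcons u n)) = th u.
  rewrite thr; have [_ /seteqP[+ _]] := chP _ (Dth u).
  by move=> /(_ (ch (th u) n)); case; first by exists n.
have thI : injective th.
  move=> u; elim/last_ind: u => [v|u n IH v].
    by case/lastP: v => [//|v m] /esym /(proj1 (thS v m)).
  case/lastP: v => [|v m] E; first by case: (proj1 (thS u n)).
  have uv : u = v by apply: IH; rewrite -(thS u n).2 E (thS v m).2.
  move: E; rewrite uv !thr => E.
  by have [/(_ _ _ E)-> _] := chP _ (Dth v).
have thsur v : D v -> exists u, th u = v.
  have [k] := ubnP (rk v); elim: k v => // k IH v kv Dv.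
  have [->|vr] := eqVneq v r; first by exists [::].
  have [Dp lp] := Dpar Dv (elimN eqP vr).
  have [u pu] := IH _ (leq_trans lp kv) Dp.
  have [_ /seteqP[_ +]] := chP _ (Dth u).
  move=> /(_ v)[|n _ <-]; first by split=> //; exact: elimN eqP vr.
  by exists (rcons u n); rewrite thr.
exists th; split=> //.
- by apply/seteqP; split=> [_ [u _ <-]|v /thsur[u <-]]; [exact: Dth|exists u].
- move=> u v; split=> [[]|[n ->]]; last exact: thS.
  case/lastP: v => [//|v n] _; rewrite (thS v n).2 => /thI ->.
  by exists n.
Qed.
End RootedTrees.

Definition subtree_embedding (V : Type) (e : V -> V -> Prop) (S : set V) :=
  exists phi : V -> V, [/\ injective phi, range phi = S &
    forall x y, e x y <-> e (phi x) (phi y)].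

(** The deleted set consists of all edges that lie inside no [S j]. By disjointness every edge
    leaving some [S j] is one of them, so its finiteness also gives that clause of [T_subtree]. *)
Lemma covering_forest_intro (V : Type) (e : V -> V -> Prop) k
    (S : 'I_k -> set V) :
  (forall j, subtree_embedding e (S j)) ->
  (forall i j x, S i x -> S j x -> i = j) ->
  (forall x, exists j, S j x) ->
  finite_set [set xy : V * V | e xy.1 xy.2 /\
                               ~ exists j, S j xy.1 /\ S j xy.2] ->
  covering_forest e S.
Proof.
move=> Semb Sdisj Scov Sfin; split.
- move=> j; split; first exact: Semb.
  apply: sub_finite_set Sfin => -[x y] /= [exy Sx nSy]; split=> // -[i [Six Siy]].
  by apply: nSy; rewrite -(Sdisj _ _ _ Six Sx).
- by move=> i j _ _ [x [Six Sjx]]; exact: Sdisj Six Sjx.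
- by apply/seteqP; split=> // x _; have [j Sj] := Scov x; exists j.
- exists [set xy : V * V | e xy.1 xy.2 /\ ~ exists j, S j xy.1 /\ S j xy.2] => //.
  move=> x y; split=> [[j [Sx Sy exy]]|[exy nF _]].
    by split=> //= -[_]; apply; exists j.
  by apply: contra_notP nF => nS; split=> // -[j [Sx Sy]]; apply: nS; exists j.
Qed.

(** * Cutting a rooted tree into finitely many copies of itself *)

Section AlmostAutomorphisms.
Variable V : countType.
Variables (e : V -> V -> Prop) (r : V) (par : V -> V) (rk : V -> nat).
Hypothesis rkE : forall v, v <> r -> rk v = (rk (par v)).+1.
Hypothesis eE : forall x y,
  e x y <-> (y <> r /\ par y = x) \/ (x <> r /\ par x = y).
Hypothesis chI : forall v, infinite_set [set w | w <> r /\ par w = v].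

Lemma tree_irrefl x : ~ e x x.
Proof. by move=> /eE[] [xr px]; have := rkE xr; rewrite px => /n_Sn. Qed.

Section Cut.
Variable D : set V.
Hypotheses (Dfin : finite_set D) (Dr : D r).

(** The number [n] is fuel. As a step to the parent lowers the rank by one and [r] lies in [D], fuel
    [rk v] suffices. *)
Fixpoint topn n v :=
  if v \in D then v else if n is m.+1 then topn m (par v) else v.

(* The root of the component of [v] once every vertex of [D] is cut off from
   its parent. *)
Definition top v := topn (rk v) v.

Lemma top_id v : D v -> top v = v.
Proof. by move=> Dv; rewrite /top; case: (rk v) => [|n] /=; rewrite mem_set. Qed.

Lemma top_par v : ~ D v -> top v = top (par v).
Proof.
move=> nDv; have vr : v <> r by move=> vr; apply: nDv; rewrite vr.
by rewrite /top (rkE vr) /= memNset.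
Qed.

(** Induction along the climb from [v] to the first ancestor in [D]. *)
Lemma topP (P : V -> Prop) :
  (forall v, D v -> P v) -> (forall v, ~ D v -> P (par v) -> P v) ->
  forall v, P v.
Proof.
move=> PD PN v; have [k] := ubnP (rk v); elim: k v => // k IH v kv.
have [|nDv] := pselect (D v); first exact: PD.
apply: PN => //; apply: IH.
have vr : v <> r by move=> vr; apply: nDv; rewrite vr.
by rewrite (rkE vr) in kv.
Qed.

Lemma top_in v : D (top v).
Proof.
elim/topP: v => [v Dv|v nDv]; first by rewrite top_id.
by rewrite (top_par nDv).
Qed.

Lemma top_rk v : (rk (top v) <= rk v)%N.
Proof.
elim/topP: v => [v Dv|v Dv]; first by rewrite top_id.
have vr : v <> r by move=> vr; apply: Dv; rewrite vr.
by rewrite (top_par Dv) (rkE vr) => /leqW.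
Qed.

(** A component is a tree rooted at [d] in which every vertex keeps infinitely many children, only
    the finite set [D] being cut off. It and the whole tree get labels in [seq nat] from
    [rooted_tree_iso]; composing the labellings embeds the tree. *)
Lemma component_embedding d : D d -> subtree_embedding e [set v | top v = d].
Proof.
move=> Dd; pose S := [set v | top v = d].
have nD v : S v -> v <> d -> ~ D v by move=> Sv vd /top_id; rewrite Sv => /esym.
have vr v : S v -> v <> d -> v <> r.
  by move=> Sv vd vr; apply: (nD _ Sv vd); rewrite vr.
have [|||th [thI thS thE]] := @rooted_tree_iso V d par S rk.
- exact: top_id.
- move=> v Sv vd; split; last by rewrite (rkE (vr _ Sv vd)).
  by rewrite /S /= -top_par//; exact: nD.
- move=> v Sv; apply: (sub_infinite_set _ (infinite_setD (@chI v) Dfin)).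
  move=> w [[wr pw] nDw]; split=> //; first by rewrite /S /= top_par// pw.
  by move=> wd; apply: nDw; rewrite wd.
have [|||t0 [t0I t0S t0E]] := @rooted_tree_iso V r par setT rk => //.
- by move=> v _ vr'; split=> //; rewrite (rkE vr').
- by move=> v _; apply: (sub_infinite_set _ (@chI v)) => w [wr pw].
have /choice[u uE] : forall x, exists u, t0 u = x.
  by move=> x; have : [set: V] x by []; rewrite -t0S => -[u _ ux]; exists u.
have uK : cancel t0 u by move=> x; apply: t0I.
have eS x y : S x -> S y ->
    e x y <-> (y <> d /\ par y = x) \/ (x <> d /\ par x = y).
  move=> Sx Sy; rewrite eE.
  (* The parent of [d] lies outside the component: its rank is below that of [d], while [top b = d]
     has rank at most that of [b]. *)
  have drop a b : S a -> S b -> a <> r -> par a = b -> a <> d.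
    move=> Sa Sb ar pa ad; have := top_rk b.
    by rewrite Sb -ad (rkE ar) pa ltnn.
  split=> -[] [xd pd]; [left|right|left|right]; split=> //.
  - exact: drop Sy Sx _ _.
  - exact: drop Sx Sy _ _.
  - exact: vr.
  - exact: vr.
have Sth w : S (th w) by rewrite -thS; exists w.
exists (th \o u); split.
- by move=> x y /= /thI /(congr1 t0); rewrite !uE.
- rewrite -/S -thS; apply/seteqP; split=> [_ [x _ <-]|_ [w _ <-]] /=.
    by exists (u x).
  by exists (t0 w) => //=; rewrite uK.
- have E a b : e (t0 a) (t0 b) <-> e (th a) (th b).
    by rewrite (eS _ _ (Sth a) (Sth b)) eE !thE !t0E.
  by move=> x y; rewrite -E !uE.
Qed.

End Cut.

(** [D] contains both ends of every edge broken by [g], and the preimages of both ends of every edge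
    broken by [g']. Two distinct points of [D] are roots of different components, so inside a
    component [g] preserves adjacency both ways. *)
Lemma almost_automorphism_spheromorphism (g g' : V -> V) :
  cancel g g' -> cancel g' g ->
  finite_set [set xy : V * V | e xy.1 xy.2 /\ ~ e (g xy.1) (g xy.2)] ->
  finite_set [set xy : V * V | e xy.1 xy.2 /\ ~ e (g' xy.1) (g' xy.2)] ->
  spheromorphism e g.
Proof.
set B := (X in finite_set X -> _); move=> gK g'K Bfin.
set B' := (X in finite_set X -> _); move=> B'fin.
pose D := r |` (fst @` B `|` snd @` B `|`
  ((g' \o fst) @` B' `|` (g' \o snd) @` B')).
have Dfin : finite_set D.
  rewrite !finite_setU; split; first exact: finite_set1.
  by do !split; exact: finite_image.
have Dr : D r by left.
have eg x y : top D x = top D y -> e x y <-> e (g x) (g y).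
  move=> txy; split=> exy; apply: contrapT => nexy.
    have Bxy : B (x, y) by [].
    have Dx : D x by right; left; left; exists (x, y).
    have Dy : D y by right; left; right; exists (x, y).
    by move: exy; rewrite -(top_id Dx) txy top_id//; exact: tree_irrefl.
  have Bxy : B' (g x, g y) by split; rewrite //= !gK.
  have Dx : D x by right; right; left; exists (g x, g y); rewrite //= gK.
  have Dy : D y by right; right; right; exists (g x, g y); rewrite //= gK.
  by move: exy; rewrite -(top_id Dx) txy top_id//; exact: tree_irrefl.
have [s0 Ds0] := (finite_seqP _).1 Dfin; pose s := undup s0.
have Ds v : D v <-> v \in s by rewrite Ds0 mem_undup; split.
pose S (j : 'I_(size s)) := [set v | top D v = nth r s j].
have SD (j : 'I_(size s)) : D (nth r s j) by apply/Ds; exact: mem_nth (ltn_ord j).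
have Sdisj i j x : S i x -> S j x -> i = j.
  rewrite /S /= => -> /eqP; rewrite nth_uniq ?undup_uniq ?ltn_ord// => /eqP.
  exact: val_inj.
have Scov x : exists j, S j x.
  have /Ds xs := top_in Dr x.
  have js : (index (top D x) s < size s)%N by rewrite index_mem.
  by exists (Ordinal js); rewrite /S /= nth_index.
(* An edge between two components joins a vertex of [D] to its parent. *)
have Sfin : finite_set [set xy : V * V | e xy.1 xy.2 /\
    ~ exists j, S j xy.1 /\ S j xy.2].
  apply: (@sub_finite_set _ _ ((fun v => (par v, v)) @` D `|`
      (fun v => (v, par v)) @` D)).
    move=> [x y] /= [/eE exy nS].
    have nt : top D x <> top D y.
      move=> txy; have [j Sj] := Scov x; apply: nS; exists j; split=> //.
      by rewrite /S /= -txy.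
    case: exy => -[xr pxy]; [left; exists y|right; exists x]; rewrite ?pxy//.
      by apply: contra_notP nt => nDy; rewrite (top_par Dr nDy) pxy.
    by apply: contra_notP nt => nDx; rewrite (top_par Dr nDx) pxy.
  by rewrite finite_setU; split; exact: finite_image.
exists (size s), S, (fun j => g @` S j); split.
- by apply: covering_forest_intro => // j; exact: component_embedding.
- apply: covering_forest_intro.
  + move=> j; have [phi [phiI phiS phiE]] := component_embedding Dfin Dr (SD j).
    exists (g \o phi); split.
    * by move=> x y /= /(can_inj gK) /phiI.
    * rewrite -[S j]phiS; apply/seteqP; split=> [_ [x _ <-]|_ [_ [x _ <-] <-]].
        by exists (phi x) => //; exists x.
      by exists x.
    * have Sphi x : top D (phi x) = nth r s j.
        have phiS' : range phi `<=` S j by rewrite phiS.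
        exact: phiS' (imageT phi x).
      by move=> x y; rewrite phiE eg//= !Sphi.
  + by move=> i j _ [x Six <-] [y Sjy] /(can_inj gK) yx; apply: Sdisj Six _;
      rewrite -yx.
  + by move=> x; have [j Sj] := Scov (g' x); exists j, (g' x).
  (* An edge between two image components is broken by [g'] or is the image of an edge between two
     components. *)
  + apply: (@sub_finite_set _ _ (B' `|` (fun xy => (g xy.1, g xy.2)) @`
      [set xy : V * V | e xy.1 xy.2 /\ ~ exists j, S j xy.1 /\ S j xy.2])).
      move=> [x y] /= [exy nS].
      have [exy'|] := pselect (e (g' x) (g' y)); last by left.
      right; exists (g' x, g' y); rewrite /= ?g'K//; split=> // -[j [Sx Sy]].
      by apply: nS; exists j; split; [exists (g' x)|exists (g' y)].
    by rewrite finite_setU; split=> //; exact: finite_image.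
- move=> j; split; last by move=> x y Sx Sy; apply: eg; rewrite Sx Sy.
  split=> [x Sx|x y _ _ /(can_inj gK)|//]; [by exists x|by []].
Qed.

End AlmostAutomorphisms.

(** * The tree of continued fractions and its ways *)

(** The parent of [p] is the next point on a shortest path from [p] to [r]. That no other edges
    exist follows by counting. *)
Lemma finite_tree_parent (T : finType) (c : rel T) (r : T) :
  symmetric c -> #|[set pq : T * T | c pq.1 pq.2]%SET| = (2 * #|T|.-1)%N ->
  (forall p q, connect c p q) ->
  exists (par : T -> T) (dist : T -> nat),
    (forall p, p <> r -> dist p = (dist (par p)).+1) /\
    (forall p q, c p q <-> (q <> r /\ par q = p) \/ (p <> r /\ par p = q)).
Proof.
move=> csym ccard cconn.
pose P p n := [exists s : n.-tuple T, path c p s && (last p s == r)].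
have exP p : exists n, P p n.
  have /connectP[s ps ls] := cconn p r; exists (size s).
  by apply/existsP; exists (in_tuple s); rewrite ps -ls /=.
pose dist p := ex_minn (exP p).
have distP p : P p (dist p) by rewrite /dist; case: ex_minnP.
have dist_min p n : P p n -> (dist p <= n)%N.
  by rewrite /dist; case: ex_minnP => m _ mmin /mmin.
have Pcons p q n : c p q -> P q n -> P p n.+1.
  move=> cpq /existsP[s /andP[ps ls]]; apply/existsP.
  by exists (cons_tuple q s); rewrite /= cpq ps.
have /choice[par parP] : forall p, exists q, p <> r ->
    c p q /\ dist p = (dist q).+1.
  move=> p; have [->|/eqP pr] := eqVneq p r; first by exists r.
  have := distP p; case E : (dist p) => [|n] /existsP[s].
    by rewrite (tuple0 s) /= => /eqP.
  case/tupleP: s => q s /= /andP[/andP[cpq ps] ls]; exists q => _; split=> //.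
  have Pq : P q n by apply/existsP; exists s; rewrite ps.
  apply/eqP; rewrite eqSS eqn_leq; apply/andP; split; last exact: dist_min.
  by rewrite -ltnS -E; apply/dist_min/(Pcons _ _ _ cpq)/distP.
have distE p : p <> r -> dist p = (dist (par p)).+1 by move=> /parP[].
exists par, dist; split=> // p q.
split=> [|[][/parP[cpq _] <-]]; [|by rewrite csym|by []].
(* The pairs in [E1] and [E2] are edges; the two sets are disjoint because [dist] drops towards the
   parent. Together they have [2 * #|T|.-1] elements, so they exhaust the edges. *)
pose E1 := [set (x, par x) | x in [set~ r]%SET]%SET.
pose E2 := [set (par x, x) | x in [set~ r]%SET]%SET.
have nr x : x \in [set~ r]%SET -> x <> r by rewrite !inE => /eqP.
have cardE1 : #|E1| = #|T|.-1 by rewrite card_imset ?cardsC1// => x y [].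
have cardE2 : #|E2| = #|T|.-1 by rewrite card_imset ?cardsC1// => x y [].
have E12 : (E1 :&: E2 = finset.set0)%SET.
  apply/setP => -[x y]; rewrite !inE; apply/negP => /andP[].
  move=> /imsetP[a /nr/distE ar [-> ->]] /imsetP[b /nr/distE br [ab ba]].
  by move: ar br; rewrite ba -ab; lia.
have sub : (E1 :|: E2 \subset [set pq : T * T | c pq.1 pq.2])%SET.
  apply/fintype.subsetP => -[x y]; rewrite !inE.
  by case/orP => /imsetP[a /nr/parP[ca _] [-> ->]]; rewrite //= csym.
have /eqP EE : (E1 :|: E2 == [set pq : T * T | c pq.1 pq.2])%SET.
  rewrite eqEcard sub ccard cardsU E12 cards0 subn0.
  by rewrite cardE1 cardE2 addnn mul2n leqnn.
move=> cpq; have : (p, q) \in [set pq : T * T | c pq.1 pq.2]%SET by rewrite inE.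
by rewrite -EE inE => /orP[] /imsetP[a /nr ar [-> ->]]; [right|left].
Qed.

Lemma edge_sym c : symmetric c -> forall x y, edge c x y -> edge c y x.
Proof.
move=> csym x y [[xy H]|[x0 y0 cxy]]; [left|right; split=> //].
  by split=> //; case: H; [right|left].
by rewrite csym.
Qed.

Lemma take_pred_rcons (T : Type) (s : seq T) x :
  take (size (rcons s x)).-1 (rcons s x) = s.
Proof. by rewrite size_rcons -cats1 take_size_cat. Qed.

Definition pos1 : posnat := Sub 1%N isT.

Lemma infinite_posnat : infinite_set [set: posnat].
Proof.
pose h (n : nat) : posnat := Sub n.+1 isT.
move=> fin; apply: infinite_nat; apply: (finite_preimage (f := h)) fin.
by move=> m n _ _ /(congr1 val) [].
Qed.

(** The tree is rooted at the initial point of an arbitrarily chosen piece. The parent map drops the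
    last term of a sequence, and on initial points it follows the finite tree of the four pieces. *)
Lemma almost_automorphism_vertex c (g g' : vertex -> vertex) :
  connecting_edges c -> cancel g g' -> cancel g' g ->
  finite_set [set xy : vertex * vertex |
    edge c xy.1 xy.2 /\ ~ edge c (g xy.1) (g xy.2)] ->
  finite_set [set xy : vertex * vertex |
    edge c xy.1 xy.2 /\ ~ edge c (g' xy.1) (g' xy.2)] ->
  spheromorphism (edge c) g.
Proof.
move=> [csym _ ccard cconn].
pose p0 : piece := (false, false).
have [|par [dist [distE cE]]] := @finite_tree_parent piece c p0 csym _ cconn.
  by rewrite ccard card_prod card_bool.
pose vpar (v : vertex) : vertex :=
  if v.2 is [::] then (par v.1, [::]) else (v.1, take (size v.2).-1 v.2).
pose vrk (v : vertex) := (dist v.1 + size v.2)%N.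
have vparS p u n : vpar (p, rcons u n) = (p, u).
  by rewrite /vpar /= take_pred_rcons; case: u.
have nilr (u : seq posnat) n : rcons u n <> [::] by case: u.
apply: (@almost_automorphism_spheromorphism _ (edge c) (p0, [::]) vpar vrk).
- move=> [p u]; case/lastP: u => [|u n] pr; last first.
    by rewrite vparS /vrk /= size_rcons addnS.
  by rewrite /vrk /= !addn0 distE// => pp0; apply: pr; rewrite pp0.
- move=> [p u] [q v]; split.
  + case=> [[/= <-] [[n ->]|[n ->]]|[/= -> -> /cE]].
    * by left; rewrite vparS; split=> // -[_ /nilr].
    * by right; rewrite vparS; split=> // -[_ /nilr].
    * by case=> -[pr <-]; [left|right]; split=> // -[].
  + case=> [[]|[]].
    * case/lastP: v => [|v n] vr.
        move=> [<- <-]; right; split=> //=; apply/cE; left; split=> //.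
        by move=> qp; apply: vr; rewrite qp.
      by rewrite vparS => -[<- <-]; left; split=> //=; left; exists n.
    * case/lastP: u => [|u n] vr.
        move=> [<- <-]; right; split=> //=; apply/cE; right; split=> //.
        by move=> qp; apply: vr; rewrite qp.
      by rewrite vparS => -[<- <-]; left; split=> //=; right; exists n.
- move=> [p u] fin; apply: infinite_posnat.
  apply: (@sub_finite_set _ _ ((fun n => (p, rcons u n)) @^-1`
      [set w | w <> (p0, [::]) /\ vpar w = (p, u)])).
    by move=> n _; split; [case=> _ /nilr|exact: vparS].
  by apply: finite_preimage fin => m n _ _ [/rcons_inj[]].
Qed.

Lemma way_equivP (V : Type) (e : V -> V -> Prop) (a b : way e) :
  way_equiv a b <-> exists M N, forall j, a (M + j)%N = b (N + j)%N.
Proof.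
split=> [[k [n0 _ n0P]]|[M [N abE]]].
  (* From index [n0 + absz k] on, the shifted index is nonnegative, so [absz] does not alter it. *)
  exists (absz (Posz (n0 + absz k) + k)%R), (n0 + absz k)%N => j.
  rewrite (n0P (n0 + absz k + j)%N) /=; last by lia.
  by congr (a _); lia.
exists (Posz M - Posz N)%R; exists N => // j /= Nj.
rewrite -{1}(subnKC Nj) -abE; congr (a _); lia.
Qed.

Lemma boundary_point_eq (V : Type) (e : V -> V -> Prop) (a b : way e) :
  boundary_point a = boundary_point b <->
  exists M N, forall j, a (M + j)%N = b (N + j)%N.
Proof.
rewrite -way_equivP; split=> [/(congr1 val) /= ab|ab].
  have : way_class b b by apply/way_equivP; exists 0%N, 0%N.
  by rewrite -ab.
apply: val_inj => /=; apply/seteqP; split=> d.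
  move: ab => /way_equivP[M [N abE]] /way_equivP[P [Q adE]].
  apply/way_equivP; exists (N + P)%N, (Q + M)%N => j.
  by rewrite -!addnA -abE addnCA adE addnA.
move: ab => /way_equivP[M [N abE]] /way_equivP[P [Q bdE]].
apply/way_equivP; exists (M + P)%N, (Q + N)%N => j.
by rewrite -!addnA abE addnCA bdE addnA.
Qed.

(** The function under [mkseq] is the word [u] followed by the infinite sequence [t]. *)
Lemma mkseq_cat (T : Type) (x0 : T) (u : seq T) (t : nat -> T) i :
  mkseq (fun k => if (k < size u)%N then nth x0 u k else t (k - size u)%N)
    (size u + i) = u ++ mkseq t i.
Proof.
apply: (@eq_from_nth _ x0) => [|k]; first by rewrite size_cat !size_mkseq.
rewrite size_mkseq => ki; rewrite nth_mkseq// nth_cat.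
by case: ltnP => // uk; rewrite nth_mkseq//; lia.
Qed.

(** A way must at some time pass to a child, since otherwise the lengths sink to zero and it is
    trapped among four initial points. Afterwards it cannot turn back without repeating a vertex, so
    each step appends one term. *)
Lemma way_eventually_prefix c (a : way (edge c)) :
  exists p s M N, forall j, a (M + j)%N = prefix_way p s (N + j)%N.
Proof.
case: a => a /= [aI aE].
have [j0 [n jn]] : exists j n, a j.+1 = ((a j).1, rcons (a j).2 n).
  apply: contrapT => /forallNP nd.
  have st j : (size (a j.+1).2 <= (size (a j).2).-1)%N.
    case: (aE j) => [[E [[n E']|[n E']]]|[_ -> _] //]; last first.
      by rewrite E' size_rcons.
    by exfalso; apply: (nd j); exists n; case: (a j.+1) E E' => q v /= <- ->.
  have sz j : (size (a j).2 <= size (a 0).2 - j)%N.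
    by elim: j => [|j IH]; [lia|have := st j; lia].
  have nl i : (a (size (a 0).2 + i)%N).2 = [::].
    by apply: size0nil; have := sz (size (a 0%N).2 + i)%N; lia.
  (* Five distinct vertices with empty sequence would lie in five distinct pieces. *)
  pose f (i : 'I_5) := (a (size (a 0).2 + i)%N).1.
  have fI : injective f.
    move=> i j fij; apply: ord_inj; apply: (@addnI (size (a 0%N).2)); apply: aI.
    by rewrite [LHS]surjective_pairing [RHS]surjective_pairing !nl; congr pair.
  by have := leq_card f fI; rewrite card_ord card_prod card_bool.
have desc i : exists n, a (j0 + i).+1 = ((a j0).1, rcons (a (j0 + i)%N).2 n)
    /\ (a (j0 + i)%N).1 = (a j0).1.
  elim: i => [|i [m [E Ep]]]; first by exists n; rewrite addn0.
  rewrite addnS; case: (aE (j0 + i).+1) => [[Ef [[l El]|[l El]]]|[nil _ _]].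
  - exists l; rewrite E /= in Ef El *; split=> //.
    by rewrite [LHS]surjective_pairing El -Ef.
  - exfalso; rewrite E /= in Ef El.
    have /aI : a (j0 + i).+2 = a (j0 + i)%N.
      rewrite [LHS]surjective_pairing [RHS]surjective_pairing -Ef Ep.
      by move/rcons_inj: El => [<- _].
    by lia.
  - by move: nil; rewrite E /=; case: (a (j0 + i)%N).2.
pose t i := last pos1 (a (j0 + i).+1).2.
have at_ i : a (j0 + i)%N = ((a j0).1, (a j0).2 ++ mkseq t i).
  elim: i => [|i IH]; first by rewrite addn0 cats0 -surjective_pairing.
  have [m [E Ep]] := desc i; rewrite addnS E IH /=; congr pair.
  rewrite rcons_cat; congr (_ ++ _).
  have -> : m = t i by rewrite /t E last_rcons.
  by rewrite /mkseq -[in RHS]addn1 iotaD map_cat cats1.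
exists (a j0).1, (fun k => if (k < size (a j0).2)%N then nth pos1 (a j0).2 k
  else t (k - size (a j0).2)%N), j0, (size (a j0).2) => j.
by rewrite /prefix_way mkseq_cat at_.
Qed.

(** * Finite continued fractions *)

Lemma posnat_gt0 (s : posnat) : (0 < sval s)%N.
Proof. exact: valP. Qed.

(* [cvec [:: s_0; ...; s_n] = (a, b)] with [a / b = [s_0; ..., s_n]] in lowest
   terms; the empty fraction is [1 / 0]. *)
Definition cvec (u : seq posnat) : nat * nat :=
  foldr (fun s w => (sval s * w.1 + w.2, w.1))%N (1, 0)%N u.

Lemma cvec_cons s u : cvec (s :: u) = (sval s * (cvec u).1 + (cvec u).2, (cvec u).1)%N.
Proof. by []. Qed.

Lemma cvec_bounds u : (0 < (cvec u).1)%N /\ ((cvec u).2 <= (cvec u).1)%N.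
Proof.
elim: u => [//|s u [IH1 IH2]]; rewrite cvec_cons /=.
by have := posnat_gt0 s; split; nia.
Qed.

Lemma cvec_coprime u : coprime (cvec u).1 (cvec u).2.
Proof.
elim: u => [//|s u IH]; rewrite cvec_cons /=.
by rewrite coprime_sym /coprime gcdnMDl.
Qed.

Lemma cvec2_eq0 u : (cvec u).2 = 0%N -> u = [::].
Proof. by case: u => // s u; have := cvec_bounds u; rewrite cvec_cons /=; lia. Qed.

Lemma cvec_eq u : (cvec u).1 = (cvec u).2 -> u = [:: pos1].
Proof.
case: u => [//|s u]; have := cvec_bounds u; rewrite cvec_cons /= => -[a0 ba] E.
have s0 := posnat_gt0 s; have b0 : (cvec u).2 = 0%N by nia.
have u0 := cvec2_eq0 b0; rewrite u0; congr cons; apply: val_inj => /=.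
by move: E; rewrite u0 /=; lia.
Qed.

(* A rational number has exactly two continued fractions, whose lengths have
   different parities. *)
Lemma cvec_inj u v : cvec u = cvec v -> odd (size u) = odd (size v) -> u = v.
Proof.
elim: u v => [|s u IH] [|t v].
- by [].
- by have := cvec_bounds v; rewrite cvec_cons /= => -[a0 _] [_ E]; rewrite -E in a0.
- by have := cvec_bounds u; rewrite cvec_cons /= => -[a0 _] [_ E]; rewrite E in a0.
rewrite !cvec_cons => -[E1 E2] /= /negb_inj odduv.
have [a0 bu] := cvec_bounds u; have [_ bv] := cvec_bounds v.
(* If the leading terms differ, they differ by one: the tail after the larger term is empty and the
   tail after the smaller one is [[:: pos1]], which contradicts the equal parities. *)
have parity w w' : (cvec w').2 = 0%N -> (cvec w).2 = (cvec w).1 ->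
    odd (size w) <> odd (size w').
  by move=> /cvec2_eq0 -> /esym/cvec_eq ->.
have [st|st|st] := ltngtP (sval s) (sval t).
- by case: (parity u v) => //; nia.
- by case: (parity v u) => //; nia.
rewrite (val_inj st); congr cons; apply: IH => //.
by rewrite [LHS]surjective_pairing [RHS]surjective_pairing; congr pair; nia.
Qed.

(** Euclid's algorithm, with the parity of the length adjusted at the end by replacing a last term
    [q] by [q - 1, 1]. This is impossible exactly for [1 / 0] and [1 / 1], whose parities the last
    two hypotheses prescribe. *)
Lemma cvec_surj a b (o : bool) : (b <= a)%N -> coprime a b ->
  (b = 0%N -> o = false) -> (a = b -> o = true) ->
  exists u, cvec u = (a, b) /\ odd (size u) = o.
Proof.
have [k] := ubnP b; elim: k a b o => // k IH a b o bk ba cab b0 ab.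
have [bz|bnz] := eqVneq b 0%N.
  exists [::]; rewrite b0// bz /=; move: cab; rewrite bz /coprime gcdn0.
  by move=> /eqP ->.
have q0 : (0 < a %/ b)%N by rewrite divn_gt0 ?lt0n.
have rb : (a %% b < b)%N by rewrite ltn_mod lt0n.
have aE := divn_eq a b.
have cr : coprime b (a %% b) by rewrite /coprime gcdnC gcdn_modl.
pose q : posnat := Sub (a %/ b)%N q0.
case: (boolP ((a %% b == 0)%N && ~~ o)) => [/andP[/eqP r0 /negbTE no]|H].
  have b1 : b = 1%N by move: cr; rewrite r0 /coprime gcdn0 => /eqP.
  have a1 : (1 < a)%N.
    by rewrite ltn_neqAle -{2}b1 ba andbT; apply/eqP => a1; rewrite ab ?b1 in no.
  have q1 : (0 < a.-1)%N by lia.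
  by exists [:: Sub a.-1 q1; pos1]; rewrite /= no b1; split=> //; congr pair; lia.
have [u [uE uo]] : exists u, cvec u = (b, a %% b)%N /\ odd (size u) = ~~ o.
  apply: IH => //; [by lia|by lia| |by lia].
  by move=> r0; move: H; rewrite r0 eqxx /= negbK => ->.
by exists (q :: u); rewrite cvec_cons uE /= uo negbK -aE.
Qed.

(** Consecutive convergents have determinant 1 up to sign, and prepending a term reverses the
    sign. *)
Lemma child_det u v : child u v ->
  if odd (size u) then ((cvec v).1 * (cvec u).2 = ((cvec u).1 * (cvec v).2).+1)%N
  else ((cvec u).1 * (cvec v).2 = ((cvec v).1 * (cvec u).2).+1)%N.
Proof.
move=> [n ->]; elim: u => [|s u /=]; first by rewrite /=; lia.
by case: (odd (size u)) => /=; nia.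
Qed.

Lemma child_cons s u v : child (s :: u) (s :: v) <-> child u v.
Proof.
by split=> -[n E]; exists n; [case: E|rewrite E].
Qed.

(** Converse of [child_det]. Equal leading terms are stripped, which exchanges the roles of the two
    sequences; when [u] is empty, the parity excludes a second term 1 in the other sequence. *)
Lemma det_child u v : ~~ odd (size u) -> odd (size v) ->
  ((cvec u).1 * (cvec v).2 = ((cvec v).1 * (cvec u).2).+1)%N ->
  child u v \/ child v u.
Proof.
have [k] := ubnP (size u + size v); elim: k u v => // k IH [|s u] [//|t v] /=.
  move=> _ _ ov; rewrite mul1n muln0 => E.
  suff -> : v = [::] by left; exists t.
  case: v ov E => // m v /= ov E; exfalso.
  have [a0 _] := cvec_bounds v; have m0 := posnat_gt0 m; move: ov.
  have b0 : (cvec v).2 = 0%N by nia.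
  by rewrite (cvec2_eq0 b0).
rewrite negbK => lk ou ov E.
have [c0 dc] := cvec_bounds u; have [c0' dc'] := cvec_bounds v.
(* The parities make the tail of the first sequence nonempty and the tail of the second different
   from [[:: pos1]]. With different leading terms the determinant would then be negative or at least
   2. *)
have d0 : (0 < (cvec u).2)%N.
  by rewrite lt0n; apply/eqP => /cvec2_eq0 u0; rewrite u0 in ou.
have nv : (cvec v).1 <> (cvec v).2 by move=> /cvec_eq v1; rewrite v1 in ov.
have [st|st|st] := ltngtP (sval s) (sval t).
- exfalso; have H1 := leq_mul st (leqnn ((cvec u).1 * (cvec v).1)).
  by have H2 := leq_mul dc (leqnn (cvec v).1); lia.
- exfalso; have H1 := leq_mul st (leqnn ((cvec u).1 * (cvec v).1)).
  have lt : ((cvec v).2 < (cvec v).1)%N by lia.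
  have H2 := leq_mul lt (leqnn (cvec u).1).
  by have H3 := leq_mul d0 c0'; lia.
rewrite (val_inj st) in E *; case: (IH v u) => //; try lia.
- by move=> vu; right; apply/child_cons.
- by move=> uv; left; apply/child_cons.
Qed.

(** * Vertices as one-sided germs *)

Local Open Scope ring_scope.

(** Signed numerator, to be read with the nonnegative denominator [vden]. In the two inner pieces
    the fraction given by [cvec] is inverted, because of the leading zero. The initial points are
    [1 / 0], [-1 / 0] and twice [0 / 1]. *)
Definition vnum (v : vertex) : int :=
  let x := Posz (if v.1.2 then (cvec v.2).1 else (cvec v.2).2) in
  if v.1.1 then - x else x.

Definition vden (v : vertex) : int :=
  Posz (if v.1.2 then (cvec v.2).2 else (cvec v.2).1).

(* The children of [v] accumulate at the rational point [vnum v / vden v] (or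
   at infinity), from the right if [side v] and from the left otherwise. *)
Definition side (v : vertex) : bool := odd (size v.2) (+) ~~ v.1.2 (+) v.1.1.

Lemma vden_ge0 v : 0 <= vden v.
Proof. by []. Qed.

Lemma vertex_coprime v : coprime `|vnum v| `|vden v|.
Proof.
case: v => -[neg big] u; rewrite /vnum /vden /=.
have C := cvec_coprime u; have C' := C; rewrite coprime_sym in C'.
by case: neg big => [] []; rewrite ?abszN ?absz_nat.
Qed.

(** To the right of infinity on the circle lie the very negative numbers, so the right germ there is
    written [-1 / 0] and the left one [1 / 0]. *)
Lemma vden0 v : vden v = 0 -> vnum v = if side v then -1 else 1.
Proof.
case: v => -[neg []] u; rewrite /vnum /vden /side /= => -[E]; last first.
  by have [] := cvec_bounds u; rewrite E.
by rewrite (cvec2_eq0 E) /=; case: neg.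
Qed.

(** At 0 the germ decides: the left one belongs to a negative piece. *)
Lemma vertex_neg v : v.1.1 = (vnum v < 0) || (vnum v == 0) && ~~ side v.
Proof.
case: v => -[n b] u; rewrite /vnum /side /=.
have [a0 _] := cvec_bounds u; have z := @cvec2_eq0 u.
case: b; first by case: n; lia.
have [E|b0] := eqVneq (cvec u).2 0%N; first by rewrite z//; case: n.
by case: n; lia.
Qed.

(** At 1 and -1 the germ pointing away from 0 belongs to the outer piece. *)
Lemma vertex_big v : v.1.2 =
  (`|vden v| < `|vnum v|)%N || (`|vden v| == `|vnum v|)%N && (side v (+) v.1.1).
Proof.
case: v => -[n b] u; rewrite /vnum /vden /side /=.
have [_ ba] := cvec_bounds u.
have -> (x : nat) : absz (if n then - Posz x else Posz x) = x.
  by case: n; rewrite ?abszN.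
rewrite -addbA addbb addbF.
have [/cvec_eq ->|ab] := eqVneq (cvec u).1 (cvec u).2; first by case: b.
by case: b => /=; lia.
Qed.

Lemma vertex_inj v w :
  vnum v = vnum w -> vden v = vden w -> side v = side w -> v = w.
Proof.
move=> En Ed Es.
have Eneg : v.1.1 = w.1.1 by rewrite !vertex_neg En Es.
have Ebig : v.1.2 = w.1.2 by rewrite !vertex_big En Ed Es Eneg.
case: v w Eneg Ebig En Ed Es => -[n b] u [[n' b'] u'] /= <- <-.
rewrite /vnum /vden /side /= => En [Ed] /addIb/addIb Es; congr pair.
apply: cvec_inj => //; rewrite [LHS]surjective_pairing [RHS]surjective_pairing.
have {}En : (if b then (cvec u).1 else (cvec u).2) =
    (if b then (cvec u').1 else (cvec u').2) by case: n En; case: (b) => /= En; lia.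
by case: b En Ed => -> ->.
Qed.

(** The bits [n] and [b] are those forced by [vertex_neg] and [vertex_big]; the side then prescribes
    the parity of the length, which [cvec_surj] provides. *)
Lemma vertex_surj (x y : int) (s : bool) : 0 <= y -> coprime `|x| `|y| ->
  (y = 0 -> x = if s then -1 else 1) ->
  exists v, [/\ vnum v = x, vden v = y & side v = s].
Proof.
move=> y0 cxy yz.
pose n := (x < 0) || (x == 0) && ~~ s.
have xE : (if n then - Posz `|x| else Posz `|x|) = x.
  rewrite /n; case: (ltrP x 0) => /= x0; first by lia.
  by case: eqP => [->|_]; [case: (~~ s)|rewrite /=; lia].
have yE : Posz `|y| = y by lia.
have eq1 : `|x|%N = `|y|%N -> `|y|%N = 1%N.
  by move=> xy; move: cxy; rewrite xy /coprime gcdnn => /eqP.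
pose b := (`|y| < `|x|)%N || (`|y| == `|x|)%N && (s (+) n).
pose a1 := if b then `|x|%N else `|y|%N; pose a2 := if b then `|y|%N else `|x|%N.
have a12 : (a2 <= a1)%N.
  by rewrite /a1 /a2 /b; case: ltngtP => [/ltnW|/ltnW|->] //=; case: ifP.
have ca : coprime a1 a2 by rewrite /a1 /a2; case: (b); rewrite // coprime_sym.
have [||u [uE uo]] := cvec_surj (o := s (+) ~~ b (+) n) a12 ca.
- rewrite /a2 /b; case: ltngtP => /= xy E.
  + have y00 : y = 0 by lia.
    by rewrite /n yz//; case: (s).
  + have x00 : x = 0 by lia.
    by rewrite /n x00 ltxx eqxx; case: (s).
  + have := eq1 (esym xy); move: E; case: ifP; lia.
- rewrite /a1 /a2 /b; case: ltngtP => /= xy; [lia|lia|].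
  by case: (s) (n) => [] [].
exists ((n, b), u); rewrite /vnum /vden /side /= uE uo /a1 /a2; split.
- by rewrite -[RHS]xE; case: (b).
- by rewrite -[RHS]yE; case: (b).
- by case: (s) (b) (n) => [] [] [].
Qed.

Definition in_piece (v w : vertex) :=
  v.1 = w.1 /\ (child v.2 w.2 \/ child w.2 v.2).

Lemma adjacent_odd u w :
  child u w \/ child w u -> odd (size w) = ~~ odd (size u).
Proof. by case=> -[m ->]; rewrite size_rcons //= negbK. Qed.

Lemma adjacent_det u w : child u w \/ child w u -> ~~ odd (size u) ->
  odd (size w) /\
  ((cvec u).1 * (cvec w).2 = ((cvec w).1 * (cvec u).2).+1)%N.
Proof.
move=> [] ch ou; have [m E] := ch; have := child_det ch.
  by rewrite (negbTE ou) E size_rcons /= ou.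
rewrite E size_rcons /= negbK in ou.
by rewrite ou.
Qed.

(** The vertex with a right germ is the left end of the arc. Change of sign and inversion each
    reverse orientation, and [side] accounts for both, so all four pieces reduce to [child_det]. *)
Lemma in_piece_det v w : in_piece v w -> side v ->
  ~~ side w /\ vnum w * vden v - vnum v * vden w = 1.
Proof.
case: v w => p u [q w] [/= <-]; case: p => n b ch.
have ch' : child w u \/ child u w by case: ch; [right|left].
rewrite /side /vnum /vden; case: n b => [] [] /=;
  rewrite ?addbF ?addbT ?negbK => ou.
- by have [-> E] := adjacent_det ch ou; split=> //; lia.
- have ow : ~~ odd (size w) by rewrite (adjacent_odd ch) negbK.
  by have [_ E] := adjacent_det ch' ow; split=> //; lia.
- have ow : ~~ odd (size w) by rewrite (adjacent_odd ch) negbK.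
  by have [_ E] := adjacent_det ch' ow; split=> //; lia.
- by have [-> E] := adjacent_det ch ou; split=> //; lia.
Qed.

(** Converse of [in_piece_det]. The three sign conditions say that 0, 1 and -1 do not separate the
    two points; hence both germs lie in the same piece, and [det_child] applies there. *)
Lemma det_in_piece v w : side v -> ~~ side w ->
  vnum w * vden v - vnum v * vden w = 1 ->
  0 <= vnum v * vnum w ->
  0 <= (vnum v - vden v) * (vnum w - vden w) ->
  0 <= (vnum v + vden v) * (vnum w + vden w) ->
  in_piece v w.
Proof.
move=> sv sw det0 H1 H2 H3; have dv := vden_ge0 v; have dw := vden_ge0 w.
have Eneg : v.1.1 = w.1.1.
  rewrite !vertex_neg sv (negbTE sw) andbF orbF andbT.
  by case: (ltrgtP (vnum v)) => v0; case: (ltrgtP (vnum w)) => w0 //=; nia.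
have Ebig : v.1.2 = w.1.2.
  rewrite !vertex_big sv (negbTE sw) -Eneg vertex_neg sv andbF orbF addTb addFb.
  move: (vnum v) (vden v) (vnum w) (vden w) det0 H1 H2 H3 dv dw.
  move=> x y x' y' det0 H1 H2 H3 dv dw.
  have [x0|x0] := ltrP x 0; rewrite /= ?andbT ?andbF ?orbF.
    have x0' : x' <= 0 by nia.
    have -> : (`|y'| < `|x'|)%N || (`|y'|%N == `|x'|%N) = (x' + y' <= 0) by lia.
    have -> : (`|y| < `|x|)%N = (x + y < 0) by lia.
    by apply/idP/idP => xy; [nia|rewrite lt_neqAle; apply/andP; split; [apply/eqP|]; nia].
  have x0' : 0 <= x' by nia.
  have -> : (`|y| < `|x|)%N || (`|y|%N == `|x|%N) = (0 <= x - y) by lia.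
  have -> : (`|y'| < `|x'|)%N = (0 < x' - y') by lia.
  by apply/idP/idP => xy; [rewrite lt_neqAle; apply/andP; split; [apply/eqP|]; nia|nia].
case: v w Eneg Ebig sv sw det0 {H1 H2 H3 dv dw} => -[n b] u [[n' b'] w] /= <- <-.
rewrite /in_piece /side /vnum /vden; case: n b => [] [] /=;
  rewrite ?addbF ?addbT ?negbK => ou ow det0; split=> //.
- by apply: det_child => //; lia.
- by apply/or_comm; apply: det_child => //; lia.
- by apply/or_comm; apply: det_child => //; lia.
- by apply: det_child => //; lia.
Qed.

(** * Arcs of the circle and Moebius maps *)

Section Arcs.
Variable R : realType.

Ltac arc_cases :=
  repeat match goal with
  | |- context [?u < ?v] => case: (ltrP u v) => ?
  | |- context [?u <= ?v] => case: (lerP u v) => ?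
  end; rewrite /= //; try by move=> *; exfalso; lra.

Ltac arc_solve := rewrite /open_arc /=; arc_cases.

Lemma open_arcl (a b : RP1 R) : ~ open_arc a b a.
Proof. by case: a b => [a|] [b|]; arc_solve. Qed.

Lemma open_arcr (a b : RP1 R) : ~ open_arc a b b.
Proof. by case: a b => [a|] [b|]; arc_solve. Qed.

Lemma open_arc_full (a x : RP1 R) : x <> a -> open_arc a a x.
Proof.
case: a x => [a|] [x|] // xa; rewrite /open_arc /= ?ltxx ?lexx //.
by rewrite -neq_lt eq_sym; apply/eqP => E; apply: xa; rewrite E.
Qed.

Lemma Some_neq (r s : R) : Some r <> Some s -> r < s \/ s < r.
Proof. by move=> rs; apply/orP; rewrite -neq_lt; apply/eqP => E; apply: rs; rewrite E. Qed.

(** Totality of the cyclic order; the lemmas after it give its rotation and transitivity laws. *)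
Lemma open_arc_total (a b x : RP1 R) : a <> b -> a <> x -> b <> x ->
  open_arc a b x \/ open_arc a x b.
Proof.
case: a b x => [a|] [b|] [x|] //; rewrite /open_arc /=;
  move=> ab ax bx; (try move: ab => /Some_neq[?|?]); try clear ab;
  (try move: ax => /Some_neq[?|?]); try clear ax;
  (try move: bx => /Some_neq[?|?]); try clear bx; arc_cases; by [left|right].
Qed.

Lemma open_arc_rot (a b x : RP1 R) : a <> b -> open_arc a b x -> open_arc b x a.
Proof.
case: a b x => [a|] [b|] [x|] //; rewrite /open_arc /=;
  move=> ab; (try move: ab => /Some_neq[?|?]); try clear ab; arc_cases.
Qed.

Lemma open_arc_subl (a b z x : RP1 R) : open_arc a b z -> open_arc a z x -> open_arc a b x.
Proof. by case: a b z x => [a|] [b|] [z|] [x|] //; arc_solve. Qed.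

Lemma open_arc_subr (a b z x : RP1 R) : open_arc a b z -> open_arc z b x -> open_arc a b x.
Proof. by case: a b z x => [a|] [b|] [z|] [x|] //; arc_solve. Qed.

Lemma open_arc_split (a b z x : RP1 R) : open_arc a b z -> open_arc a b x ->
  [\/ x = z, open_arc a z x | open_arc z b x].
Proof.
have [->|/eqP xz] := eqVneq x z; first by constructor 1.
case: a b z x xz => [a|] [b|] [z|] [x|] // xz; rewrite /open_arc /=;
  (try move: xz => /Some_neq[?|?]); try clear xz; arc_cases;
  move=> *; by [constructor 2|constructor 3].
Qed.

(** The point [c] is the first one of [C] met after [a]; it is [a] itself only if [C] is the
    singleton of [a]. *)
Lemma arc_next (C : set (RP1 R)) (a : RP1 R) : finite_set C -> C !=set0 ->
  exists2 c, C c & forall y, C y -> ~ open_arc a c y.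
Proof.
move=> /finite_seqP[s ->] [c0 /= c0s].
elim: s c0 c0s => // c s IH c0 _.
case: s IH => [|c1 s] IH.
  by exists c => [|y]; rewrite /= inE// => /eqP ->; exact: open_arcr.
have [m ms mP] := IH c1 (mem_head _ _).
have [mc|nmc] := pselect (open_arc a m c).
  exists c => [|y]; rewrite /= inE ?eqxx// => /orP[/eqP ->|ys].
    exact: open_arcr.
  by move=> /(open_arc_subl mc); exact: mP.
exists m => [|y]; rewrite /= inE ?ms ?orbT// => /orP[/eqP ->//|ys].
exact: mP.
Qed.

Lemma arc_prev (C : set (RP1 R)) (a : RP1 R) : finite_set C -> C !=set0 ->
  exists2 c, C c & forall y, C y -> ~ open_arc c a y.
Proof.
move=> /finite_seqP[s ->] [c0 /= c0s].
elim: s c0 c0s => // c s IH c0 _.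
case: s IH => [|c1 s] IH.
  by exists c => [|y]; rewrite /= inE// => /eqP ->; exact: open_arcl.
have [m ms mP] := IH c1 (mem_head _ _).
have [mc|nmc] := pselect (open_arc m a c).
  exists c => [|y]; rewrite /= inE ?eqxx// => /orP[/eqP ->|ys].
    exact: open_arcl.
  by move=> /(open_arc_subr mc); exact: mP.
exists m => [|y]; rewrite /= inE ?ms ?orbT// => /orP[/eqP ->//|ys].
exact: mP.
Qed.

(** The nearest cuts on both sides of [z]. They may coincide, and the open arc is then the
    complement of one point. *)
Lemma cuts_around (C : set (RP1 R)) (z : RP1 R) :
  finite_set C -> C !=set0 -> ~ C z ->
  exists c1 c2, [/\ C c1, C c2, open_arc c1 c2 z,
    forall y, C y -> ~ open_arc c1 z y & forall y, C y -> ~ open_arc z c2 y].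
Proof.
move=> Cfin C0 nCz.
have [c2 Cc2 next] := arc_next z Cfin C0.
have [c1 Cc1 prev] := arc_prev z Cfin C0.
have zc1 : z <> c1 by move=> E; apply: nCz; rewrite E.
have zc2 : z <> c2 by move=> E; apply: nCz; rewrite E.
exists c1, c2; split=> //.
have [<-|/eqP c12] := eqVneq c1 c2; first exact: open_arc_full.
have [//|c1zc2] := open_arc_total c12 (nesym zc1) (nesym zc2).
by case: (prev _ Cc2).
Qed.

Lemma no_cut_between (C : set (RP1 R)) (c1 c2 z : RP1 R) :
  ~ C z -> open_arc c1 c2 z -> (forall y, C y -> ~ open_arc c1 z y) ->
  (forall y, C y -> ~ open_arc z c2 y) -> C `&` open_arc c1 c2 = set0.
Proof.
move=> nCz c12z prev next; apply/seteqP; split=> // y [Cy c12y].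
have [yz|/(prev _ Cy)//|/(next _ Cy)//] := open_arc_split c12z c12y.
by apply: nCz; rewrite -yz.
Qed.

(** The cuts nearest to the interior point [z] cannot lie inside the arc, so the arc ends no later
    than they do on either side. *)
Lemma arc_between_cuts (C : set (RP1 R)) (a b z : RP1 R) :
  finite_set C -> C !=set0 ->
  open_arc a b z -> C `&` open_arc a b = set0 ->
  exists c1 c2, [/\ C c1, C c2, C `&` open_arc c1 c2 = set0 &
                    closed_arc a b `<=` closed_arc c1 c2].
Proof.
move=> Cfin C0 abz Cab.
have nC y : C y -> ~ open_arc a b y.
  by move=> Cy aby; have : (C `&` open_arc a b) y by []; rewrite Cab.
have nCz : ~ C z by move=> /nC.
have [c1 [c2 [Cc1 Cc2 c12z prev next]]] := cuts_around Cfin C0 nCz.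
have zc1 : z <> c1 by move=> E; apply: nCz; rewrite E.
have zc2 : z <> c2 by move=> E; apply: nCz; rewrite E.
have ac : a = c1 \/ open_arc c1 z a.
  have [->|/eqP ac] := eqVneq a c1; [by left|right].
  have az : a <> z by move=> E; move: abz; rewrite E; exact: open_arcl.
  have [azc1|ac1z] := open_arc_total az ac zc1; last exact: open_arc_rot ac ac1z.
  by case: (nC _ Cc1); exact: open_arc_subl abz azc1.
have bc : b = c2 \/ open_arc z c2 b.
  have [->|/eqP bc] := eqVneq b c2; [by left|right].
  have zb : z <> b by move=> E; move: abz; rewrite E; exact: open_arcr.
  have [//|zbc2] := open_arc_total zc2 zb (nesym bc).
  by case: (nC _ Cc2); exact: open_arc_subr abz zbc2.
exists c1, c2; split=> //; first exact: no_cut_between nCz c12z prev next.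
move=> x [abx|[->|->]]; last 2 first.
- by case: ac => [->|/(open_arc_subl c12z)]; [right; left|left].
- by case: bc => [->|/(open_arc_subr c12z)]; [right; right|left].
left; have [->//|azx|zbx] := open_arc_split abz abx.
  apply: open_arc_subl c12z _.
  by case: ac => [<-//|ca]; exact: open_arc_subr ca azx.
apply: open_arc_subr c12z _.
by case: bc => [<-//|cb]; exact: open_arc_subl cb zbx.
Qed.

End Arcs.

(** * Homogeneous coordinates and the cyclic order *)

Section Moebius.
Variable R : realType.

(* Homogeneous coordinates: [p] is the line through [(hx p, hy p)]. *)
Definition hx (p : RP1 R) : R := if p is Some r then r else 1.
Definition hy (p : RP1 R) : R := if p is Some _ then 1 else 0.

Lemma RP1_eq (p q : RP1 R) : hx p * hy q = hx q * hy p -> p = q.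
Proof.
case: p q => [p|] [q|] //=; rewrite ?mulr1 ?mulr0 ?mul1r.
- by move=> ->.
- by move=> /esym/eqP; rewrite oner_eq0.
- by move=> /eqP; rewrite oner_eq0.
Qed.

Definition ratpt (x y : int) : RP1 R :=
  if y == 0 then None else Some (x%:~R / y%:~R).

Lemma ratptP (x y : int) : (x, y) != 0 ->
  exists2 l : R, l != 0 &
    x%:~R = l * hx (ratpt x y) /\ y%:~R = l * hy (ratpt x y).
Proof.
rewrite xpair_eqE negb_and /ratpt; have [->|y0] := eqVneq y 0.
  by rewrite orbF => x0; exists x%:~R; rewrite ?intr_eq0//= mulr0 mulr1.
by exists y%:~R; rewrite ?intr_eq0//= mulr1 mulrC divfK ?intr_eq0.
Qed.

Lemma ratpt_unique (x y : int) (p : RP1 R) (l : R) : l != 0 ->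
  x%:~R = l * hx p -> y%:~R = l * hy p -> ratpt x y = p.
Proof.
move=> l0 xE yE; rewrite /ratpt -(intr_eq0 R) yE mulf_eq0 (negbTE l0) /=.
case: p xE yE => [p|] /= xE yE; rewrite ?eqxx// oner_eq0 xE mulr1.
by rewrite mulrAC divff ?mul1r.
Qed.

Definition hdet (p q : RP1 R) : R := hx p * hy q - hx q * hy p.

(** Each point enters the product twice, so rescaling its coordinates multiplies the product by a
    square. The cyclic order is thus a sign that linear maps of determinant 1 preserve. *)
Lemma open_arc_hdet (p q x : RP1 R) : p <> q ->
  open_arc p q x <-> 0 < hdet p x * hdet x q * hdet q p.
Proof.
have N (r s t : R) : (0 < r * s * t) =
    [|| [&& 0 < r, 0 < s & 0 < t], [&& 0 < r, s < 0 & t < 0],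
        [&& r < 0, 0 < s & t < 0] | [&& r < 0, s < 0 & 0 < t]].
  case: (ltrgtP r 0) => [r0|r0|->]; last by rewrite !mul0r ltxx.
    case: (ltrgtP s 0) => [s0|s0|->]; last by rewrite mulr0 mul0r ltxx.
      by rewrite pmulr_rgt0 ?nmulr_rgt0//= orbF.
    by rewrite nmulr_rgt0 ?nmulr_rlt0//= orbF.
  case: (ltrgtP s 0) => [s0|s0|->]; last by rewrite mulr0 mul0r ltxx.
    by rewrite nmulr_rgt0 ?pmulr_rlt0//= orbF.
  by rewrite pmulr_rgt0 ?pmulr_rgt0//= orbF.
case: p q x => [p|] [q|] [x|] //; rewrite N /open_arc /hdet /= => pq;
  rewrite ?(mulr1, mulr0, mul1r, mul0r, sub0r, subr0)
    ?(subr_gt0, subr_lt0, oppr_gt0, oppr_lt0, ltr01, ltr10) /=;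
  (try move: pq => /Some_neq[?|?]); try clear pq.
all: repeat match goal with
  | |- context [?u < ?v] => case: (ltrP u v) => ?
  | |- context [?u <= ?v] => case: (lerP u v) => ?
  end; rewrite /= //; try by move=> *; exfalso; lra.
Qed.

Variables a b c d : int.
Hypothesis det1 : a * d - b * c = 1.

Let det1R : a%:~R * d%:~R - b%:~R * c%:~R = 1 :> R.
Proof. by rewrite -!rmorphM -rmorphB det1. Qed.

(** In homogeneous coordinates [moebius] is a linear map up to a factor, which is nonzero because
    the matrix is invertible. *)
Lemma moebiusP (p : RP1 R) : exists2 l : R, l != 0 &
  a%:~R * hx p + b%:~R * hy p = l * hx (moebius a b c d p) /\
  c%:~R * hx p + d%:~R * hy p = l * hy (moebius a b c d p).
Proof.
case: p => [r|] /=; rewrite !(mulr1, mulr0, addr0).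
  have [E|cd0] := eqVneq; last first.
    by exists (c%:~R * r + d%:~R) => //=; rewrite mulr1 mulrCA divff// mulr1.
  exists (a%:~R * r + b%:~R); rewrite /= ?mulr0 ?mulr1 ?E//.
  apply/eqP => E'; have := oner_neq0 R.
  rewrite -det1R => /eqP; apply.
  have [c0|c0] := eqVneq (c%:~R : R) 0.
    by move: E; rewrite c0 mul0r add0r => ->; rewrite !mulr0 subr0.
  apply: (mulfI c0); rewrite mulr0; nra.
have [c0|c0] := eqVneq c 0; last first.
  by exists c%:~R; rewrite /= ?intr_eq0// mulr1 mulrCA divff ?mulr1 ?intr_eq0.
exists a%:~R; rewrite /= ?c0 ?mulr1 ?mulr0//.
apply/eqP => a0; have /eqP := oner_neq0 R; apply.
by rewrite -det1R a0 c0 mul0r mulr0 subr0.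
Qed.

Lemma moebius_ratpt (x y : int) : (x, y) != 0 ->
  moebius a b c d (ratpt x y) = ratpt (a * x + b * y) (c * x + d * y).
Proof.
move=> xy0; have [k k0 [xE yE]] := ratptP xy0.
have [l l0 [XE YE]] := moebiusP (ratpt x y).
apply/esym/(@ratpt_unique _ _ _ (k * l)); first by rewrite mulf_neq0.
  by rewrite rmorphD !rmorphM /= -mulrA -XE xE yE; ring.
by rewrite rmorphD !rmorphM /= -mulrA -YE xE yE; ring.
Qed.

Lemma moebius_hdet (p q x : RP1 R) : let g := @moebius R a b c d in
  (0 < hdet p x * hdet x q * hdet q p) =
  (0 < hdet (g p) (g x) * hdet (g x) (g q) * hdet (g q) (g p)).
Proof.
move=> g.
have [lp lp0 [pX pY]] := moebiusP p; have [lq lq0 [qX qY]] := moebiusP q.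
have [lx lx0 [xX xY]] := moebiusP x.
have E u v (lu lv : R) : a%:~R * hx u + b%:~R * hy u = lu * hx (g u) ->
    c%:~R * hx u + d%:~R * hy u = lu * hy (g u) ->
    a%:~R * hx v + b%:~R * hy v = lv * hx (g v) ->
    c%:~R * hx v + d%:~R * hy v = lv * hy (g v) ->
    hdet u v = lu * lv * hdet (g u) (g v).
  move=> uX uY vX vY; rewrite /hdet -[LHS]mul1r -det1R.
  transitivity ((lu * hx (g u)) * (lv * hy (g v)) - (lv * hx (g v)) * (lu * hy (g u))).
    by rewrite -uX -uY -vX -vY; ring.
  by ring.
rewrite (E p x lp lx)// (E x q lx lq)// (E q p lq lp)//.
set P := (X in _ = (0 < X)).
have -> : lp * lx * hdet (g p) (g x) * (lx * lq * hdet (g x) (g q)) *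
    (lq * lp * hdet (g q) (g p)) = (lp * lx * lq) ^+ 2 * P by rewrite /P; ring.
by rewrite pmulr_rgt0// exprn_even_gt0//= !mulf_neq0.
Qed.
End Moebius.

Lemma moebiusK (R : realType) (a b c d : int) : a * d - b * c = 1 ->
  cancel (@moebius R a b c d) (moebius d (- b) (- c) a).
Proof.
move=> det1 p; have det1' : d * a - (- b) * (- c) = 1 by lia.
have [l l0 [XE YE]] := moebiusP det1 p.
have [k k0 [XE' YE']] := moebiusP det1' (moebius a b c d p).
have det1R : a%:~R * d%:~R - b%:~R * c%:~R = 1 :> R.
  by rewrite -!rmorphM -rmorphB det1.
apply: RP1_eq; move: XE YE XE' YE'; rewrite !rmorphN /=.
move: (moebius a b c d p) => q; move: (moebius _ _ _ _ q) => p'.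
set ar := a%:~R in det1R *; set br := b%:~R in det1R *.
set cr := c%:~R in det1R *; set dr := d%:~R in det1R *.
move=> XE YE XE' YE'; apply: (mulfI l0); apply: (mulfI k0).
have -> : k * (l * (hx p' * hy p)) = l * (k * hx p') * hy p by ring.
have -> : k * (l * (hx p * hy p')) = l * (k * hy p') * hx p by ring.
rewrite -XE' -YE'.
have -> : l * (dr * hx q + - br * hy q) = dr * (l * hx q) - br * (l * hy q) by ring.
have -> : l * (- cr * hx q + ar * hy q) = ar * (l * hy q) - cr * (l * hx q) by ring.
rewrite -XE -YE; ring.
Qed.

Lemma moebius_open_arc (R : realType) (a b c d : int) (p q x : RP1 R) :
  a * d - b * c = 1 ->
  open_arc (moebius a b c d p) (moebius a b c d q) (moebius a b c d x) <->
  open_arc p q x.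
Proof.
move=> det1; have gI := can_inj (@moebiusK R _ _ _ _ det1).
have [<-|/eqP pq] := eqVneq p q.
  split=> H; apply: open_arc_full => E; move: H; rewrite ?E; first exact: open_arcl.
  by rewrite (gI _ _ E); exact: open_arcl.
rewrite open_arc_hdet; last by move=> /gI.
by rewrite -(moebius_hdet det1) open_arc_hdet.
Qed.

(** * Piecewise Moebius maps and the tree *)

Definition RP1Q (R : realType) : set (RP1 R) := [set None] `|` Some @` @rational R.

Definition piecewise_moebius (R : realType) (f : RP1 R -> RP1 R) (C : set (RP1 R)) :=
  forall p q, C p -> C q -> C `&` open_arc p q = set0 ->
    exists a b c d : int, a * d - b * c = 1 /\
      forall x, closed_arc p q x -> f x = moebius a b c d x.

Section RationalPoints.
Variable R : realType.

Lemma RP1Q_ratpt (x y : int) : RP1Q (@ratpt R x y).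
Proof.
rewrite /ratpt; case: eqP => [_|y0]; first by left.
right; exists (x%:~R / y%:~R) => //; exists (x%:~R / y%:~R) => //.
by rewrite fmorph_div !rmorph_int.
Qed.

(** The bit [s] selects one of the two signs for infinity, in accordance with [vden0]. *)
Lemma ratpt_RP1Q (p : RP1 R) (s : bool) : RP1Q p ->
  exists x y, [/\ @ratpt R x y = p, 0 <= y, coprime `|x| `|y| &
                  y = 0 -> x = if s then -1 else 1].
Proof.
case=> [->|[_ [q _ <-] <-]].
  exists (if s then -1 else 1), 0; split=> //.
  by case: s.
exists (numq q), (denq q); split=> //; last by move/eqP; rewrite denq_eq0.
- by rewrite /ratpt denq_eq0 /ratr.
- exact: coprime_num_den.
Qed.

Lemma ratpt_coprime_eq (x y x' y' : int) :
  @ratpt R x y = @ratpt R x' y' -> 0 <= y -> 0 <= y' ->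
  coprime `|x| `|y| -> coprime `|x'| `|y'| -> y = y' /\ (y <> 0 -> x = x').
Proof.
rewrite /ratpt; case: eqP => [->|/eqP y0]; case: eqP => [->|/eqP y0'] //.
case=> /eqP; rewrite eqr_div ?intr_eq0// -!intrM eqr_int => /eqP E yg yg' cxy cxy'.
have En : (`|x| * `|y'| = `|x'| * `|y|)%N by rewrite -!abszM E.
have yy : `|y|%N = `|y'|%N.
  apply/eqP; rewrite eqn_dvd; apply/andP; split.
    by rewrite -(@Gauss_dvdr _ `|x|) 1?coprime_sym// En dvdn_mull.
  by rewrite -(@Gauss_dvdr _ `|x'|) 1?coprime_sym// -En dvdn_mull.
have yy' : y = y' by lia.
split=> // _; apply: (mulIf y0'); rewrite E yy'; lia.
Qed.

Lemma moebius_RP1Q (a b c d : int) (p : RP1 R) : a * d - b * c = 1 ->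
  RP1Q p -> RP1Q (moebius a b c d p).
Proof.
move=> det1 /(ratpt_RP1Q true)[x [y [<- y0 cxy _]]].
rewrite moebius_ratpt//; first exact: RP1Q_ratpt.
by apply: contraTneq cxy => -[-> ->].
Qed.

End RationalPoints.

Section PiecewiseMoebius.
Variables (R : realType) (f : RP1 R -> RP1 R) (C : set (RP1 R)).
Hypotheses (Cfin : finite_set C) (C0 : C !=set0).
Hypothesis fC : piecewise_moebius f C.

Lemma piecewise_moebius_point (p : RP1 R) : exists a b c d : int,
  a * d - b * c = 1 /\ f p = moebius a b c d p.
Proof.
have [Cp|nCp] := pselect (C p).
  have [c2 Cc2 next] := arc_next p Cfin C0.
  have [|a [b [c [d [det1 fE]]]]] := fC Cp Cc2.
    by apply/seteqP; split=> // y [Cy /(next _ Cy)].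
  by exists a, b, c, d; split=> //; apply: fE; right; left.
have [c1 [c2 [Cc1 Cc2 c12 prev next]]] := cuts_around Cfin C0 nCp.
have [a [b [c [d [det1 fE]]]]] := fC Cc1 Cc2 (no_cut_between nCp c12 prev next).
by exists a, b, c, d; split=> //; apply: fE; left.
Qed.

Lemma piecewise_moebius_RP1Q (p : RP1 R) : RP1Q p -> RP1Q (f p).
Proof.
have [a [b [c [d [det1 ->]]]]] := piecewise_moebius_point p.
exact: moebius_RP1Q.
Qed.

Lemma piecewise_moebius_arc (a b z : RP1 R) :
  open_arc a b z -> C `&` open_arc a b = set0 ->
  exists k l m n : int, k * n - l * m = 1 /\
    forall x, closed_arc a b x -> f x = moebius k l m n x.
Proof.
move=> abz Cab.
have [c1 [c2 [Cc1 Cc2 C12 sub]]] := arc_between_cuts Cfin C0 abz Cab.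
have [k [l [m [n [det1 fE]]]]] := fC Cc1 Cc2 C12.
by exists k, l, m, n; split=> // x /sub; exact: fE.
Qed.

(** It suffices that consecutive image cuts come from consecutive cuts; on that arc the inverse
    matrix works. *)
Lemma piecewise_moebius_inv (g : RP1 R -> RP1 R) : cancel f g -> cancel g f ->
  piecewise_moebius g (f @` C).
Proof.
move=> fK gK _ _ [c1 Cc1 <-] [c2 Cc2 <-] C12.
have nC y : C y -> ~ open_arc (f c1) (f c2) (f y).
  move=> Cy H; have : (f @` C `&` open_arc (f c1) (f c2)) (f y).
    by split=> //; exists y.
  by rewrite C12.
have [c3 Cc3 next] := arc_next c1 Cfin C0.
have [|a [b [c [d [det1 fE]]]]] := fC Cc1 Cc3.
  by apply/seteqP; split=> // y [Cy /(next _ Cy)].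
have det1' : d * a - (- b) * (- c) = 1 by lia.
have mK : cancel (moebius d (- b) (- c) a) (@moebius R a b c d).
  by have := @moebiusK R _ _ _ _ det1'; rewrite !opprK.
have fI := can_inj fK.
have f1 : f c1 = moebius a b c d c1 by apply: fE; right; left.
have f3 : f c3 = moebius a b c d c3 by apply: fE; right; right.
(* Otherwise [f c2] lies between [f c1] and [f c3]. The Moebius map that agrees with [f] from [c1]
   to [c3] preserves arcs, so [c2] would be a cut between [c1] and its successor [c3]. *)
have c32 : c3 = c2.
  apply: contrapT => c32.
  have [c12|/eqP c12] := eqVneq c1 c2.
    by apply: (nC _ Cc3); rewrite -c12; apply: open_arc_full => /fI; rewrite c12.
  have [c13|/eqP c13] := eqVneq c1 c3.
    by apply: (next _ Cc2); rewrite -c13; exact/open_arc_full/nesym.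
  have [|||/(nC _ Cc3)//|] := @open_arc_total _ (f c1) (f c2) (f c3).
  - by move/fI.
  - by move/fI.
  - by move/fI/esym.
  rewrite f1 f3 -{1}(mK (f c2)) moebius_open_arc// => H.
  apply: (next _ Cc2); rewrite (_ : c2 = moebius d (- b) (- c) a (f c2))//.
  by apply: fI; rewrite [in RHS]fE ?mK//; left.
exists d, (- b), (- c), a; split=> // x H; apply: fI; rewrite gK.
have yc : closed_arc c1 c3 (moebius d (- b) (- c) a x).
  case: H => [H|[->|->]].
  - left; apply/(moebius_open_arc _ _ _ det1); rewrite mK.
    by rewrite -f1 -f3 c32.
  - by right; left; rewrite f1 moebiusK.
  - by right; right; rewrite -c32 f3 moebiusK.
by rewrite fE// mK.
Qed.

End PiecewiseMoebius.

(** Terms of equal sign do not cancel, and the nonzero integers [s] and [t] have absolute value at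
    least 1. *)
Lemma norm_combination (u u' s t : int) : 0 <= u * u' -> 0 < s * t ->
  `|u| <= `|u' * s + u * t| /\ `|u'| <= `|u' * s + u * t|.
Proof.
move=> uu st.
wlog [s0 t0] : s t {st} / 0 < s /\ 0 < t.
  move=> H; have [s0|s0] := lerP s 0; last first.
    by apply: H; split=> //; rewrite pmulr_rgt0 in st.
  have sN : s != 0 by apply: contraTneq st => ->; rewrite mul0r.
  have s0' : s < 0 by rewrite lt_neqAle sN.
  have t0 : t < 0 by rewrite nmulr_rgt0 in st.
  by have := H (- s) (- t); rewrite !mulrN -opprD normrN; apply; lia.
wlog [u0 u0'] : u u' {uu} / 0 <= u /\ 0 <= u'.
  move=> H; have [[u0 u0']|[u0 u0']] : 0 <= u /\ 0 <= u' \/ u <= 0 /\ u' <= 0.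
  - by nia.
  - exact: H.
  - by have := H (- u) (- u'); rewrite !mulNr -opprD !normrN; apply; lia.
by rewrite !ger0_norm ?addr_ge0 ?mulr_ge0 ?(ltW s0) ?(ltW t0)//; split; nia.
Qed.

(** * Vertices as germs on the circle, and edges across a rational point *)

Section VertexPoints.
Variable R : realType.

Definition vpt (v : vertex) : RP1 R := ratpt R (vnum v) (vden v).

Lemma vpt_eq (v : vertex) (x y : int) : vpt v = ratpt R x y -> 0 <= y ->
  coprime `|x| `|y| -> (y = 0 -> x = if side v then -1 else 1) ->
  vnum v = x /\ vden v = y.
Proof.
move=> E y0 cxy yz.
have [Ed En] := ratpt_coprime_eq E (vden_ge0 v) y0 (vertex_coprime v) cxy.
split=> //; have [v0|v0] := eqVneq (vden v) 0; last by apply/En/eqP.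
by rewrite vden0// yz// -Ed.
Qed.

Lemma vpt_inj (v w : vertex) : vpt v = vpt w -> side v = side w -> v = w.
Proof.
move=> E s; have [||En Ed] := vpt_eq E (vden_ge0 w) => //.
- exact: vertex_coprime.
- by move=> /vden0; rewrite s.
exact: vertex_inj.
Qed.

Lemma vpt_surj (p : RP1 R) (s : bool) : RP1Q p ->
  exists v, vpt v = p /\ side v = s.
Proof.
move=> /(ratpt_RP1Q s)[x [y [<- y0 cxy yz]]].
have [v [En Ed Es]] := vertex_surj y0 cxy yz.
by exists v; rewrite /vpt En Ed.
Qed.

Lemma vpt_RP1Q (v : vertex) : RP1Q (vpt v).
Proof. exact: RP1Q_ratpt. Qed.

Lemma ratpt_neq0 (x y : int) : coprime `|x| `|y| -> (x, y) != 0.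
Proof. by move=> cxy; apply: contraTneq cxy => -[-> ->]. Qed.

(** The triple product of [open_arc_hdet] with its third determinant equal to 1, as an inequality
    between integers. *)
Lemma open_arc_ratpt (x y x' y' m n : int) :
  (x, y) != 0 -> (m, n) != 0 -> x' * y - x * y' = 1 ->
  open_arc (ratpt R x y) (ratpt R x' y') (ratpt R m n) <->
  0 < (x * n - m * y) * (m * y' - x' * n).
Proof.
move=> xy0 mn0 det1.
have xy0' : (x', y') != 0.
  by apply/eqP => -[x0 y0]; move: det1; rewrite x0 y0; lia.
have [k k0 [xE yE]] := ratptP R xy0; have [k' k0' [xE' yE']] := ratptP R xy0'.
have [l l0 [mE nE]] := ratptP R mn0.
have pq : ratpt R x y <> ratpt R x' y'.
  move=> E; have /eqP := oner_neq0 R; apply.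
  rewrite -[1]/(1%:~R) -det1 rmorphB !rmorphM /= xE yE xE' yE' E; ring.
rewrite open_arc_hdet//.
have -> : (0 < (x * n - m * y) * (m * y' - x' * n)) =
    (0 < ((x * n - m * y) * (m * y' - x' * n) * (x' * y - x * y'))%:~R :> R).
  by rewrite ltr0z det1 mulr1.
rewrite !(rmorphM, rmorphB) /= xE yE xE' yE' mE nE /hdet.
set p := ratpt R x y; set q := ratpt R x' y'; set z := ratpt R m n.
set P := (X in 0 < X <-> _).
have -> : (k * hx p * (l * hy z) - l * hx z * (k * hy p)) *
    (l * hx z * (k' * hy q) - k' * hx q * (l * hy z)) *
    (k' * hx q * (k * hy p) - k * hx p * (k' * hy q)) =
    (k * l * k') ^+ 2 * P by rewrite /P; ring.
have k2 : 0 < (k * l * k') ^+ 2 by rewrite exprn_even_gt0//= !mulf_neq0.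
by rewrite (pmulr_rgt0 _ k2).
Qed.

Lemma vertex_ball_finite (N : nat) :
  finite_set [set v : vertex | (`|vnum v| <= N)%N /\ (`|vden v| <= N)%N].
Proof.
pose I := [set z : int | (`|z| <= N)%N].
have If : finite_set I.
  apply: (@sub_finite_set _ _ (Posz @` `I_N.+1 `|` (fun n => - Posz n) @` `I_N.+1)).
    move=> z; rewrite /I /= => zN.
    have [z0|z0] := lerP 0 z; [left|right]; exists `|z|%N => //=; lia.
  by rewrite finite_setU; split; apply: finite_image; exact: finite_II.
have h : finite_set (I `*` I `*` [set: bool]).
  exact: (finite_setX (finite_setX If If) finite_finset).
apply: sub_finite_set (finite_preimage (f := fun v => (vnum v, vden v, side v)) _ h).
  by move=> v [].
move=> v w _ _ /= E; have /= En := congr1 (fst \o fst) E.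
by have /= Ed := congr1 (snd \o fst) E; apply: vertex_inj (congr1 snd E).
Qed.

Lemma in_piece_num (v w : vertex) : in_piece v w -> 0 <= vnum v * vnum w.
Proof.
by case: v w => -[n b] u [[n' b'] u'] [/= [<- <-] _]; rewrite /vnum /=; case: n; nia.
Qed.

Lemma edges_across_finite (r : RP1 R) : RP1Q r ->
  finite_set [set vw : vertex * vertex |
    [/\ in_piece vw.1 vw.2, side vw.1 & open_arc (vpt vw.1) (vpt vw.2) r]].
Proof.
move=> /(ratpt_RP1Q true)[m [n [<- n0 cmn _]]].
have F := vertex_ball_finite (maxn `|m| `|n|).
apply: sub_finite_set (finite_setX F F) => -[v w] [].
rewrite [(v, w).1]/= [(v, w).2]/= => vw sv.
change (open_arc (vpt v) (vpt w) (ratpt R m n) ->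
  ((`|vnum v| <= maxn `|m| `|n|)%N /\ (`|vden v| <= maxn `|m| `|n|)%N) /\
  ((`|vnum w| <= maxn `|m| `|n|)%N /\ (`|vden w| <= maxn `|m| `|n|)%N)).
have [_ det1] := in_piece_det vw sv.
rewrite open_arc_ratpt//; [|exact/ratpt_neq0/vertex_coprime|exact: ratpt_neq0].
have xx := in_piece_num vw; have yv := vden_ge0 v; have yw := vden_ge0 w.
move: (vnum v) (vden v) (vnum w) (vden w) det1 xx yv yw => x y x' y' det1 xx yv yw st.
(* Coefficients, by Cramer's rule, of [(m, n)] in terms of the two end vectors. They have the same
   sign since the point is inside the arc. *)
pose s := m * y - x * n; pose t := x' * n - m * y'.
have st0 : 0 < s * t by move: st; rewrite /s /t; nia.
have mE : m = x' * s + x * t.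
  by rewrite -[LHS]mulr1 -det1 /s /t; ring.
have nE : n = y' * s + y * t.
  by rewrite -[LHS]mulr1 -det1 /s /t; ring.
have [H1 H2] := norm_combination xx st0; rewrite -mE in H1 H2.
have [H3 H4] := norm_combination (mulr_ge0 yv yw) st0; rewrite -nE in H3 H4.
by clear -H1 H2 H3 H4; split; split; lia.
Qed.

End VertexPoints.

Lemma in_piece_side v w : in_piece v w -> side w = ~~ side v.
Proof.
by case: v w => p u [q w] [/= <- ch]; rewrite /side /= (adjacent_odd ch) !addNb.
Qed.

Lemma mulz_eqN1 (m n : int) : 0 <= n -> m * n = -1 -> m = -1.
Proof.
move=> n0 mn; have n1 : 1 <= n by case: (ltrgtP n 0) mn => [||->]; lia.
by nia.
Qed.

Section VertexMaps.
Variable R : realType.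

(* The end points of the four pieces. *)
Definition corners : set (RP1 R) := [set None; Some 0; Some 1; Some (- 1)].

Lemma corners_ratpt (x y : int) : [\/ x = 0, y = 0, x = y | x = - y] ->
  corners (ratpt R x y).
Proof.
rewrite /ratpt; case: eqP => [_ _|y0]; first by do 3 left.
have yR : (y%:~R : R) != 0 by rewrite intr_eq0; apply/eqP.
case=> [->|//|->|->]; first by rewrite mul0r; left; left; right.
  by rewrite divff//; left; right.
by rewrite rmorphN /= mulNr divff//; right.
Qed.

Lemma finite_corners : finite_set corners.
Proof. by rewrite /corners !finite_setU; do !split; exact: finite_set1. Qed.

Variables (f : RP1 R -> RP1 R) (C : set (RP1 R)).
Hypotheses (Cfin : finite_set C) (C0 : C !=set0) (CQ : C `<=` @RP1Q R).
Hypothesis fC : piecewise_moebius f C.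

(** With no break inside the arc, [f] is a single Moebius map there and the images of the end
    vectors still have determinant 1. With no corner inside the image arc, [det_in_piece]
    applies. *)
Lemma in_piece_image (v w v' w' : vertex) :
  in_piece v w -> side v ->
  (forall r, RP1Q r -> open_arc (vpt R v) (vpt R w) r -> ~ C r /\ ~ corners (f r)) ->
  vpt R v' = f (vpt R v) -> side v' = side v ->
  vpt R w' = f (vpt R w) -> side w' = side w ->
  in_piece v' w'.
Proof.
move=> vw sv avoid v'E sv' w'E sw'.
have [sw det1] := in_piece_det vw sv.
have v0 := ratpt_neq0 (vertex_coprime v); have w0 := ratpt_neq0 (vertex_coprime w).
rewrite /vpt in avoid v'E w'E.
set x := vnum v in avoid v'E det1 v0; set y := vden v in avoid v'E det1 v0.
set x' := vnum w in avoid w'E det1 w0; set y' := vden w in avoid w'E det1 w0.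
(* Positive integer combinations of the end vectors are rational points inside the arc; the mediant
   below shows that it is not empty. *)
have comb (s t : int) : 0 < s -> 0 < t ->
    (s * x + t * x', s * y + t * y') != 0 /\
    open_arc (ratpt R x y) (ratpt R x' y') (ratpt R (s * x + t * x') (s * y + t * y')).
  move=> s0 t0.
  have c0 : (s * x + t * x', s * y + t * y') != 0.
    apply/eqP => -[E1 E2].
    have : t * (x' * y - x * y') = 0.
      by rewrite (_ : _ * _ = (s * x + t * x') * y - x * (s * y + t * y'));
        [rewrite E1 E2; ring|ring].
    by rewrite det1; lia.
  split=> //; apply/open_arc_ratpt => //.
  rewrite (_ : _ * _ = s * t * (x' * y - x * y') ^+ 2); last by ring.
  by rewrite det1 expr1n mulr1 mulr_gt0.
have [_ mid] := comb 1 1 isT isT.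
have [|a [b [c [d [gdet fE]]]]] := piecewise_moebius_arc Cfin C0 fC mid.
  apply/seteqP; split=> // r [Cr vwr]; have [nCr _] := avoid r (CQ Cr) vwr.
  exact: nCr.
have fv : f (ratpt R x y) = ratpt R (a * x + b * y) (c * x + d * y).
  by rewrite fE ?moebius_ratpt//; right; left.
have fw : f (ratpt R x' y') = ratpt R (a * x' + b * y') (c * x' + d * y').
  by rewrite fE ?moebius_ratpt//; right; right.
(* A linear form that vanishes only at corners cannot have opposite signs [l], [l'] at the ends of
   the image: with the weights of [arcz] it would vanish at the image of a rational point inside the
   arc. *)
have no_corner (al be : int) :
    (forall X Y : int, al * X + be * Y = 0 -> corners (ratpt R X Y)) ->
    0 <= (al * (a * x + b * y) + be * (c * x + d * y)) *
         (al * (a * x' + b * y') + be * (c * x' + d * y')).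
  move=> cor; rewrite leNgt; apply/negP.
  set l := al * _ + _; set l' := al * _ + be * (c * x' + _) => ll'.
  have l0 : 0 < `|l| by rewrite normr_gt0; apply/eqP => E; move: ll'; rewrite E mul0r.
  have l0' : 0 < `|l'| by rewrite normr_gt0; apply/eqP => E; move: ll'; rewrite E mulr0.
  have [z0 arcz] := comb _ _ l0' l0.
  have [_ nc] := avoid _ (RP1Q_ratpt _ _ _) arcz; apply: nc.
  rewrite fE; last by left.
  rewrite moebius_ratpt//; apply: cor.
  have -> : al * (a * (`|l'| * x + `|l| * x') + b * (`|l'| * y + `|l| * y')) +
      be * (c * (`|l'| * x + `|l| * x') + d * (`|l'| * y + `|l| * y')) =
      `|l'| * l + `|l| * l' by rewrite /l /l'; ring.
  by case: (lerP 0 l) => lg; case: (lerP 0 l') => lg'; nia.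
have N1 := no_corner 1 0; have N2 := no_corner 0 1.
have N3 := no_corner 1 (-1); have N4 := no_corner 1 1.
move: fv fw N1 N2 N3 N4 {no_corner}; rewrite -v'E -w'E.
have det2 : (a * x' + b * y') * (c * x + d * y) -
    (a * x + b * y) * (c * x' + d * y') = 1.
  transitivity ((a * d - b * c) * (x' * y - x * y')); first by ring.
  by rewrite gdet det1 mulr1.
move: (a * x + b * y) (c * x + d * y) (a * x' + b * y') (c * x' + d * y') det2.
move=> X Y X' Y' det2 fv fw N1 N2 N3 N4.
have {}N1 : 0 <= X * X'.
  have := N1 _; rewrite !mul1r !mul0r !addr0; apply=> m n.
  by rewrite mul0r addr0 mul1r => m0; apply: corners_ratpt; constructor 1.
have {}N2 : 0 <= Y * Y'.
  have := N2 _; rewrite !mul1r !mul0r !add0r; apply=> m n.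
  by rewrite mul0r add0r mul1r => n0; apply: corners_ratpt; constructor 2.
have {}N3 : 0 <= (X - Y) * (X' - Y').
  have := N3 _; rewrite !mul1r !mulN1r; apply=> m n.
  by rewrite mul1r mulN1r => mn; apply: corners_ratpt; constructor 3; lia.
have {}N4 : 0 <= (X + Y) * (X' + Y').
  have := N4 _; rewrite !mul1r; apply=> m n.
  by rewrite !mul1r => mn; apply: corners_ratpt; constructor 4; lia.
have ratptN (m n : int) : ratpt R (- m) (- n) = ratpt R m n.
  by rewrite /ratpt oppr_eq0 !rmorphN /= invrN mulrNN.
(* The image vectors are known up to a common sign. By [N2] one choice makes both denominators
   nonnegative. *)
have [X1 [Y1 [X2 [Y2 [E1 E2 [Y1g Y2g] det3 [M1 M2 M3]]]]]] :
  exists X1 Y1 X2 Y2 : int,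
    [/\ vpt R v' = ratpt R X1 Y1, vpt R w' = ratpt R X2 Y2, 0 <= Y1 /\ 0 <= Y2,
        X2 * Y1 - X1 * Y2 = 1 &
        [/\ 0 <= X1 * X2, 0 <= (X1 - Y1) * (X2 - Y2) & 0 <= (X1 + Y1) * (X2 + Y2)]].
  have [[Y0 Y0']|[Y0 Y0']] : 0 <= Y /\ 0 <= Y' \/ Y <= 0 /\ Y' <= 0 by nia.
    by exists X, Y, X', Y'.
  exists (- X), (- Y), (- X'), (- Y'); rewrite !ratptN; split=> //; first by lia.
    by rewrite !mulrNN.
  by rewrite mulrNN -!opprD !mulrNN.
have coprime1 (m n p q : int) : m * n - p * q = 1 -> coprime `|m| `|q|.
  move=> E; apply/coprimezP; exists (n, - p) => /=; lia.
have [|||Ev1 Ev2] := vpt_eq E1 => //.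
- by apply: (coprime1 _ (- Y2) (- X2) _); lia.
(* At infinity the determinant fixes the sign of the numerator, in agreement with the side. *)
- by rewrite sv' sv => Y10; apply: (mulz_eqN1 Y2g); rewrite Y10 in det3; lia.
have [|||Ew1 Ew2] := vpt_eq E2 => //.
- by apply: (coprime1 _ Y1 X1 _); lia.
- rewrite sw' (negbTE sw) => Y20; apply: oppr_inj; apply: (mulz_eqN1 Y1g).
  by rewrite Y20 in det3; lia.
by apply: det_in_piece; rewrite ?Ev1 ?Ev2 ?Ew1 ?Ew2 ?sv' ?sw'.
Qed.

(** A broken edge inside a copy spans an arc across a break point or a preimage of a corner. [E]
    lists such edges with the right germ first, so the swapped pairs are added. *)
Lemma almost_edge_preserving (c : rel piece) (f' : RP1 R -> RP1 R)
    (g : vertex -> vertex) :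
  symmetric c -> cancel f f' ->
  (forall v, vpt R (g v) = f (vpt R v) /\ side (g v) = side v) ->
  finite_set [set vw : vertex * vertex |
    edge c vw.1 vw.2 /\ ~ edge c (g vw.1) (g vw.2)].
Proof.
move=> csym fK gE.
pose B := (C `|` f' @` corners) `&` @RP1Q R.
have Bfin : finite_set B.
  apply: finite_setIl; rewrite finite_setU; split=> //.
  exact/finite_image/finite_corners.
pose E := \bigcup_(r in B) [set vw : vertex * vertex |
    [/\ in_piece vw.1 vw.2, side vw.1 & open_arc (vpt R vw.1) (vpt R vw.2) r]].
have Efin : finite_set E.
  by apply: bigcup_finite => // r [_ /edges_across_finite].
have good v w : in_piece v w -> side v -> ~ E (v, w) -> edge c (g v) (g w).
  move=> vw sv nE; left; apply: (in_piece_image vw sv).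
  - move=> r rQ vwr.
    have nB : ~ B r by move=> Br; apply: nE; exists r => //; exact: And3 vw sv vwr.
    by split=> H; apply: nB; split=> //; [left|right; exists (f r)].
  - by have [] := gE v.
  - by have [] := gE v.
  - by have [] := gE w.
  - by have [] := gE w.
(* Edges between initial points may all be broken; there are finitely many pairs. *)
pose roots := (fun pq : piece * piece =>
  ((pq.1, [::]), (pq.2, [::])) : vertex * vertex) @` setT.
apply: (@sub_finite_set _ _ (roots `|` (E `|` (fun vw => (vw.2, vw.1)) @` E))).
  move=> [v w] /= [evw nedge]; have [vw|[v0 w0 _]] := evw; last first.
    left; exists (v.1, w.1) => //; congr pair; [rewrite -v0|rewrite -w0];
      by rewrite -surjective_pairing.
  right; have [sv|nsv] := boolP (side v).
    by left; apply: contrapT => nE; apply: nedge; exact: good.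
  right; exists (w, v) => //=.
  have wv : in_piece w v by case: vw => e H; split; [exact: esym e|case: H; [right|left]].
  apply: contrapT => nE; apply: nedge; apply: edge_sym => //; apply: good => //.
  by have := in_piece_side wv; rewrite (negbTE nsv); case: (side w).
by rewrite finite_setU; split; [exact: finite_image finite_finset|
  rewrite finite_setU; split=> //; exact: finite_image].
Qed.

End VertexMaps.

(** * Infinite continued fractions *)

Section ContinuedFractions.
Variable R : realType.
Implicit Types (s : nat -> posnat) (u : seq posnat) (t y z : R).

(** The continued fraction with terms [u] followed by the complete quotient [t]. *)
Definition cfv u t : R := foldr (fun d y => (sval d)%:R + y^-1) t u.

Lemma cfv_cons d u t : cfv (d :: u) t = (sval d)%:R + (cfv u t)^-1.
Proof. by []. Qed.

Lemma cfv_cat u v t : cfv (u ++ v) t = cfv u (cfv v t).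
Proof. exact: foldr_cat. Qed.

Lemma cfv_rcons u d t : cfv (rcons u d) t = cfv u ((sval d)%:R + t^-1).
Proof. by rewrite -cats1 cfv_cat. Qed.

Lemma posnat_ge1 (d : posnat) : 1 <= (sval d)%:R :> R.
Proof. by rewrite ler1n posnat_gt0. Qed.

Lemma cfv_ge1 u t : 1 <= t -> 1 <= cfv u t.
Proof.
move=> t1; elim: u => // d u IH; rewrite cfv_cons.
by rewrite (le_trans (posnat_ge1 d))// lerDl invr_ge0 (le_trans ler01).
Qed.

Lemma cfv_gt1 u t : 1 < t -> 1 < cfv u t.
Proof.
move=> t1; elim: u => // d u IH; rewrite cfv_cons.
by rewrite (le_lt_trans (posnat_ge1 d))// ltrDl invr_gt0 (lt_trans ltr01).
Qed.

Lemma dist_inv y z : 0 < y -> 0 < z -> `|y^-1 - z^-1| = `|y - z| / (y * z).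
Proof.
move=> y0 z0; have yn := lt0r_neq0 y0; have zn := lt0r_neq0 z0.
have -> : y^-1 - z^-1 = (z - y) / (y * z) by field; rewrite yn zn.
have yz0 : 0 < (y * z)^-1 by rewrite invr_gt0 mulr_gt0.
by rewrite normrM (gtr0_norm yz0) distrC.
Qed.

(** The first term bounds the distance by 1, and every two further terms divide it by at least 4,
    which is more than the rate [1 / (n + 1)] requires. *)
Lemma cfv_dist n u t t' : (n.*2 < size u)%N -> 1 <= t -> 1 <= t' ->
  `|cfv u t - cfv u t'| <= n.+1%:R^-1.
Proof.
move=> + t1 t1'.
have ge1 v : 1 <= cfv v t /\ 1 <= cfv v t' by split; exact: cfv_ge1.
have gt0 v : 0 < cfv v t /\ 0 < cfv v t'.
  by have [? ?] := ge1 v; split; apply: lt_le_trans ltr01 _.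
have subK (a b e : R) : a + b - (a + e) = b - e by ring.
elim: n u => [|n IH] [|d u] //.
  move=> _; rewrite !cfv_cons subK invr1.
  have [p p'] := gt0 u; have [q q'] := ge1 u.
  have [i0 i0'] : 0 < (cfv u t)^-1 /\ 0 < (cfv u t')^-1 by rewrite !invr_gt0.
  have [i1 i1'] : (cfv u t)^-1 <= 1 /\ (cfv u t')^-1 <= 1 by rewrite !invf_le1.
  by rewrite ler_norml; apply/andP; split; lra.
case: u => [//|d' u]; rewrite doubleS [size _]/= !ltnS => su.
rewrite !cfv_cons subK dist_inv; last 2 first.
- by have [] := gt0 (d' :: u).
- by have [] := gt0 (d' :: u).
rewrite subK; have [p p'] := gt0 u; have [q q'] := ge1 u.
rewrite dist_inv// -mulrA -invfM.
(* A complete quotient [w] times the preceding one is [d' * w + 1], at least 2; [D] is the product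
   of two such numbers, one for [t] and one for [t']. *)
set D := (X in _ / X).
have D4 : 4 <= D.
  have E (w : R) : 0 < w -> w * ((sval d')%:R + w^-1) = (sval d')%:R * w + 1.
    by move=> w0; rewrite mulrDr divff ?lt0r_neq0// mulrC.
  have -> : D = (cfv u t * ((sval d')%:R + (cfv u t)^-1)) *
      (cfv u t' * ((sval d')%:R + (cfv u t')^-1)) by rewrite /D; ring.
  rewrite !E//; have d1 := posnat_ge1 d'.
  have h (w : R) : 1 <= w -> 2 <= (sval d')%:R * w + 1 by move=> w1; nra.
  by have := h _ q; have := h _ q'; nra.
have := IH _ su; move: (`|_|) => e ee.
have D0 : 0 < D by lra.
rewrite ler_pdivrMr//; apply: (le_trans ee).
have n0 : (0 : R) <= n%:R by rewrite ler0n.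
rewrite -[leLHS]mul1r ler_pdivrMr ?ltr0n// -mulrA mulrC ler_pdivlMr ?ltr0n//.
by rewrite -!natr1; nra.
Qed.

Lemma cvg_of_dist (a : nat -> R) (l : R) :
  (forall n m, (n.*2 < m)%N -> `|a m - l| <= n.+1%:R^-1) -> a @ \oo --> l.
Proof.
move=> al; apply/cvgrPdist_le => e e0.
have [n _ nP] := near_infty_natSinv_lt (PosNum e0).
exists n.*2.+1 => // m /= nm; rewrite distrC.
by rewrite (le_trans (al _ _ nm))// ltW//; exact: (nP n (leqnn n)).
Qed.

Lemma cvg_of_cauchy (a : nat -> R) :
  (forall n m m', (n.*2 < m)%N -> (n.*2 < m')%N -> `|a m - a m'| <= n.+1%:R^-1) ->
  cvg (a @ \oo).
Proof.
move=> H; apply: cauchy_cvg; apply: cauchy_exP => e e0.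
have [n _ nP] := near_infty_natSinv_lt (PosNum e0).
exists (a n.*2.+1); exists n.*2.+1 => // m /= nm.
rewrite -ball_normE /=; apply: le_lt_trans (nP n (leqnn n)).
exact: H.
Qed.

Lemma mkseqS_head s n : mkseq s n.+1 = s 0%N :: mkseq (fun i => s i.+1) n.
Proof. by rewrite /mkseq /= -[1%N]addn0 iotaDl -map_comp. Qed.

Lemma mkseqS s n : mkseq s n.+1 = rcons (mkseq s n) (s n).
Proof. by rewrite /mkseq -[n.+1]addn1 iotaD map_cat cats1. Qed.

Lemma convergent_cfv s n :
  convergent R n (fun i => val (s i)) = cfv (mkseq s n) (sval (s n))%:R.
Proof.
elim: n s => [//|n IH] s; rewrite mkseqS_head cfv_cons.
by rewrite -(IH (fun i => s i.+1)).
Qed.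

Lemma mkseq_split s n m :
  mkseq s (n + m) = mkseq s n ++ mkseq (fun i => s (n + i)%N) m.
Proof.
by rewrite /mkseq iotaD map_cat add0n -[X in iota X m]addn0 iotaDl -map_comp.
Qed.

Lemma convergent_tail s n m : (n <= m)%N ->
  exists2 t : R, 1 <= t & convergent R m (fun i => val (s i)) = cfv (mkseq s n) t.
Proof.
move=> nm; rewrite convergent_cfv -(subnKC nm) mkseq_split cfv_cat.
eexists; last by []. exact/cfv_ge1/posnat_ge1.
Qed.

Lemma cfv_cvg s y : (forall n, exists2 t : R, 1 <= t & y = cfv (mkseq s n) t) ->
  is_cfrac y (fun i => val (s i)).
Proof.
move=> sy; apply: cvg_of_dist => n m nm.
have [t t1 ->] := sy m; have [t' t1' ->] := convergent_tail s (leqnn m).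
by apply: cfv_dist => //; rewrite size_mkseq.
Qed.

Lemma cfrac_exists s : exists2 y : R, 1 <= y & is_cfrac y (fun i => val (s i)).
Proof.
have /cvg_ex[y sy] : cvg ((fun m => convergent R m (fun i => val (s i))) @ \oo).
  apply: cvg_of_cauchy => n m m' nm nm'.
  have [t t1 ->] := convergent_tail s nm; have [t' t1' ->] := convergent_tail s nm'.
  by apply: cfv_dist => //; rewrite size_mkseq.
exists y => //; apply: (closed_cvg (fun x : R => 1 <= x)) sy.
  exact: closed_ge.
by apply: nearW => m; have [t t1 ->] := convergent_tail s (leq0n m).
Qed.

Lemma cfrac_step s y y' : is_cfrac y (fun i => val (s i)) ->
  is_cfrac y' (fun i => val (s i.+1)) -> 1 <= y' -> y = (sval (s 0%N))%:R + y'^-1.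
Proof.
move=> sy sy' y1'.
have H1 : (fun m => convergent R m.+1 (fun i => val (s i))) @ \oo --> y.
  by rewrite (cvg_shiftS (fun m => convergent R m (fun i => val (s i)))).
have H2 : (fun m => (sval (s 0%N))%:R +
    (convergent R m (fun i => val (s i.+1)))^-1) @ \oo --> (sval (s 0%N))%:R + y'^-1.
  apply: cvgD; first exact: cvg_cst.
  by apply: cvgV => //; rewrite lt0r_neq0// (lt_le_trans ltr01).
exact: (cvg_unique (@Rhausdorff R) H1 H2).
Qed.

(** The complete quotients: [T n] is the value of the sequence shifted by [n]. *)
Lemma cfrac_tails s y : is_cfrac y (fun i => val (s i)) ->
  exists T : nat -> R, [/\ T 0%N = y, forall n, 1 < T n &
    forall n, T n = (sval (s n))%:R + (T n.+1)^-1].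
Proof.
move=> sy.
have /choice[T TP] : forall n, exists t : R,
    1 <= t /\ is_cfrac t (fun i => val (s (n + i)%N)).
  by move=> n; have [t t1 tP] := cfrac_exists (fun i => s (n + i)%N); exists t.
have TS n : T n = (sval (s n))%:R + (T n.+1)^-1.
  have [_ cn] := TP n; have [n1 cn1] := TP n.+1.
  have := @cfrac_step (fun i => s (n + i)%N) _ (T n.+1) cn; rewrite addn0; apply=> //.
  rewrite (_ : (fun i => val (s (n + i.+1)%N)) = (fun i => val (s (n.+1 + i)%N)))//.
  by apply/funext => i; rewrite addnS.
exists T; split=> //.
- have [_ c0] := TP 0%N.
  exact: (cvg_unique (@Rhausdorff R)
    (F := (fun m => convergent R m (fun i => val (s i))) @ \oo)).
- move=> n; rewrite TS (le_lt_trans (posnat_ge1 (s n)))// ltrDl invr_gt0.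
  by have [h _] := TP n.+1; exact: lt_le_trans h.
Qed.

Lemma tails_cfv s (T : nat -> R) :
  (forall n, T n = (sval (s n))%:R + (T n.+1)^-1) ->
  forall n, T 0%N = cfv (mkseq s n) (T n).
Proof. by move=> TS; elim=> [//|n IH]; rewrite mkseqS cfv_rcons -TS. Qed.

(** As the tails exceed 1, their inverses lie strictly between 0 and 1, and each term is an integral
    part. *)
Lemma cfv_inj u u' t t' : size u = size u' -> 1 < t -> 1 < t' ->
  cfv u t = cfv u' t' -> u = u'.
Proof.
elim: u u' => [|d u IH] [|d' u'] // [su] t1 t1'; rewrite !cfv_cons => E.
have [c c'] : 1 < cfv u t /\ 1 < cfv u' t' by split; exact: cfv_gt1.
have [p p'] : 0 < (cfv u t)^-1 /\ 0 < (cfv u' t')^-1.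
  by rewrite !invr_gt0; split; exact: lt_trans ltr01 _.
have [q q'] : (cfv u t)^-1 < 1 /\ (cfv u' t')^-1 < 1.
  by rewrite !invf_lt1 // (lt_trans ltr01).
have dd : d = d'.
  apply: val_inj => /=; apply/eqP; rewrite eqn_leq.
  by apply/andP; split; rewrite -ltnS -(ltr_nat R) -natr1; lra.
move: E; rewrite dd => /addrI/invr_inj /IH -> //.
Qed.

Lemma cfrac_unique s s' y : is_cfrac y (fun i => val (s i)) ->
  is_cfrac y (fun i => val (s' i)) -> s = s'.
Proof.
move=> /cfrac_tails[T [T0 T1 TS]] /cfrac_tails[T' [T0' T1' TS']].
apply/funext => n; have E := T0; rewrite -T0' in E.
rewrite (tails_cfv TS n.+1) (tails_cfv TS' n.+1) in E.
have := cfv_inj _ (T1 _) (T1' _) E; rewrite !size_mkseq => /(_ erefl).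
by rewrite !mkseqS => /rcons_inj[].
Qed.

End ContinuedFractions.

(** * Expansions of irrational numbers and surjectivity of the coding *)

Section Irrationals.
Variable R : realType.
Implicit Types (s : nat -> posnat) (x y t : R).

Lemma irrationalV t : irrational t -> irrational t^-1.
Proof.
by move=> it [q _ qt]; apply: it; exists q^-1 => //; rewrite fmorphV /= qt invrK.
Qed.

Lemma irrationalN t : irrational t -> irrational (- t).
Proof.
by move=> it [q _ qt]; apply: it; exists (- q) => //; rewrite rmorphN /= qt opprK.
Qed.

Lemma irrationalBn t n : irrational t -> irrational (t - n%:R).
Proof.
move=> it [q _ qt]; apply: it; exists (q + n%:R) => //.
by rewrite rmorphD rmorph_nat /= qt subrK.
Qed.

Lemma irrational_neq_int t (z : int) : irrational t -> t <> z%:~R.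
Proof. by move=> it tz; apply: it; exists z%:~R => //; rewrite rmorph_int. Qed.

(* Infinite descent on the denominators of the complete quotients. *)
Lemma cfrac_irrational s t : is_cfrac t (fun i => val (s i)) -> irrational t.
Proof.
move=> /cfrac_tails[T [<- T1 TS]].
have nofrac q : forall p n, (0 < q)%N -> T n * q%:R <> p%:R.
  have [k] := ubnP q; elim: k q => // k IH q qk p n q0 E.
  have Tp : 0 < T n.+1 by apply: lt_trans ltr01 _.
  have q0R : (0 : R) < q%:R by rewrite ltr0n.
  (* If [T n = p / q], then [T n.+1] is [q] over [p - sval (s n) * q], a smaller denominator since
     [T n.+1] exceeds 1. *)
  have E' : q%:R / T n.+1 = p%:R - (sval (s n) * q)%:R.
    by rewrite -E (TS n) natrM; ring.
  have qT : 0 < q%:R / T n.+1 by rewrite divr_gt0.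
  have qT' : q%:R / T n.+1 < q%:R.
    by rewrite ltr_pdivrMr// -[ltLHS]mulr1 ltr_pM2l.
  have sp : (sval (s n) * q < p)%N by rewrite -(ltr_nat R); lra.
  rewrite -natrB ?(ltnW sp)// in E'.
  apply: (IH (p - sval (s n) * q)%N _ q n.+1).
  - by rewrite -ltnS (leq_trans _ qk)// ltnS -(ltr_nat R) -E'.
  - by rewrite subn_gt0.
  - by rewrite -E' mulrC divfK// lt0r_neq0.
move=> [x _ xT].
have dq : (denq x)%:~R = `|denq x|%N%:R :> R by rewrite -[in LHS](gtz0_abs (denq_gt0 x)).
apply: (nofrac `|denq x|%N `|numq x|%N 0%N); first by rewrite absz_gt0 denq_eq0.
have T0 : 0 < T 0%N by apply: lt_trans ltr01 _.
have E : T 0%N * (denq x)%:~R = (numq x)%:~R.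
  by rewrite -xT /ratr divfK// intr_eq0 denq_eq0.
rewrite -dq E -[in LHS](@gtz0_abs (numq x))//.
by rewrite -(ltr_int R) -E mulr_gt0// ltr0z denq_gt0.
Qed.

(** The complete quotients are the iterated inverses of fractional parts; irrationality keeps the
    fractional parts nonzero. *)
Lemma cfrac_of_irrational t : irrational t -> 1 < t ->
  exists s, is_cfrac t (fun i => val (s i)).
Proof.
move=> it t1; pose next (y : R) := (y - (Num.truncn y)%:R)^-1.
pose T n := iter n next t.
have TP n : irrational (T n) /\ 1 < T n.
  elim: n => [//|n [iT T1]]; rewrite /T iterS -/(T n).
  split; first exact/irrationalV/irrationalBn.
  have /andP[l u] := truncn_itv (ltW (lt_trans ltr01 T1)).
  have d0 : 0 < T n - (Num.truncn (T n))%:R.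
    rewrite subr_gt0 lt_neqAle l andbT; apply/eqP => E.
    exact: (@irrational_neq_int _ (Posz (Num.truncn (T n))) iT).
  by rewrite invf_gt1// ltrBlDl natr1.
have tr0 n : (0 < Num.truncn (T n))%N.
  have [_ T1] := TP n; have /andP[_ u] := truncn_itv (ltW (lt_trans ltr01 T1)).
  by have := lt_trans T1 u; rewrite ltr1n ltnS.
exists (fun n => Sub (Num.truncn (T n)) (tr0 n)); apply: cfv_cvg => n.
exists (T n); first by have [_ /ltW] := TP n.
apply: (@tails_cfv _ _ T) => m.
by rewrite (_ : T m.+1 = next (T m))// /next invrK [sval _]/= addrC subrK.
Qed.

Lemma normr_irrational_neq1 x : irrational x -> `|x| != 1.
Proof.
move=> ix; apply/eqP => x1; have [x0|x0] := lerP 0 x.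
  by apply: (@irrational_neq_int _ 1 ix); rewrite -x1 ger0_norm.
by apply: (@irrational_neq_int _ (- 1) ix); rewrite rmorphN /= -x1 ltr0_norm ?opprK.
Qed.

Lemma irrational_neq0 x : irrational x -> x != 0.
Proof. by move=> ix; apply/eqP; exact: (@irrational_neq_int _ 0 ix). Qed.

(** For irrational [x] and [p = piece_of x], the one of the absolute value and its inverse that
    exceeds 1, whose expansion has no leading zero. *)
Definition big_part (p : piece) x : R := if p.2 then `|x| else `|x|^-1.

(** A leading zero inverts the convergents and delays them by one index; inversion is continuous at
    the nonzero limit. *)
Lemma is_cfrac_terms (p : piece) s x : irrational x ->
  is_cfrac `|x| (cfrac_terms p s) <-> is_cfrac (big_part p x) (fun i => val (s i)).
Proof.
move=> ix; rewrite /big_part /is_cfrac /cfrac_terms; case: p => n [] //=.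
have x0 : `|x| != 0 by rewrite normr_eq0 irrational_neq0.
rewrite -cvg_shiftS; set u := fun m => convergent R m _.
have -> : [sequence (fun m => convergent R m
    (fun i => if i is j.+1 then val (s j) else 0%N)) n.+1]_n = (fun m => (u m)^-1).
  by apply/funext => m; rewrite /= add0r.
split=> H; last by rewrite -[`|x|]invrK; apply: cvgV => //; rewrite invr_eq0.
have -> : u = (fun m => ((u m)^-1)^-1) by apply/funext => m; rewrite invrK.
exact: cvgV.
Qed.

(** An expansion exists, so [xget] does not fall back on its default. *)
Lemma partial_quotientsP x : irrational x ->
  is_cfrac `|x| (cfrac_terms (piece_of x) (partial_quotients x)).
Proof.
move=> ix.
apply: (@xgetPex _ _ [set s | is_cfrac `|x| (cfrac_terms (piece_of x) s)]).
have [||s sP] := @cfrac_of_irrational (big_part (piece_of x) x).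
- rewrite /big_part; have inx : irrational `|x|.
    have [x0|x0] := lerP 0 x; first by rewrite ger0_norm.
    by rewrite ltr0_norm//; exact: irrationalN ix.
  by case: ifP => // _; exact: irrationalV inx.
- rewrite /big_part /piece_of [snd _]/=; case: (ltrP 1 `|x|) => /= x1 //.
  rewrite invf_gt1 ?normr_gt0 ?irrational_neq0//.
  by rewrite lt_neqAle normr_irrational_neq1.
by exists s; apply/is_cfrac_terms.
Qed.

Lemma Xi_surj (c : rel piece) (p : piece) s :
  exists x : irr R, piece_of (val x) = p /\ partial_quotients (val x) = s.
Proof.
have [t t1 st] := cfrac_exists R s.
have it := cfrac_irrational st.
have {}t1 : 1 < t.
  rewrite lt_neqAle t1 andbT; apply/eqP => E; exact: (@irrational_neq_int _ 1 it).
have t0 : 0 < t by apply: lt_trans t1.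
pose m := if p.2 then t else t^-1.
have m0 : 0 < m by rewrite /m; case: ifP; rewrite ?invr_gt0.
pose x := if p.1 then - m else m.
have ix : irrational x.
  have im : irrational m by rewrite /m; case: ifP => // _; exact: irrationalV it.
  by rewrite /x; case: ifP => // _; exact: irrationalN im.
have xm : `|x| = m by rewrite /x; case: ifP; rewrite ?normrN gtr0_norm.
have px : piece_of x = p.
  rewrite /piece_of xm [RHS]surjective_pairing; congr pair.
    by rewrite /x; case: p.1; rewrite ?oppr_lt0 ?m0// ltNge ltW.
  by rewrite /m; case: p.2; rewrite ?t1// ltNge invf_le1 // ltW.
have bx : big_part p x = t by rewrite /big_part xm /m; case: p.2; rewrite ?invrK.
exists (SigSub (mem_set ix)); split=> //=.
(* Uniqueness of the expansion forces [xget] to return [s]. *)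
rewrite /partial_quotients; apply: xget_unique.
  by rewrite px /=; apply/is_cfrac_terms => //; rewrite bx.
move=> s' /=; rewrite px => /(is_cfrac_terms _ _ ix); rewrite bx => s't.
exact: cfrac_unique s't st.
Qed.

Lemma cfv_cvec u d : cfv u (sval d)%:R =
  (cvec (rcons u d)).1%:R / (cvec (rcons u d)).2%:R :> R.
Proof.
elim: u => [|e u IH]; first by rewrite /= muln1 addn0 divr1.
rewrite cfv_cons IH rcons_cons cvec_cons /= invf_div natrD natrM.
have [a0 _] := cvec_bounds (rcons u d).
by rewrite [RHS]mulrDl mulfK // pnatr_eq0 -lt0n.
Qed.

(** The vertices on the way coded by [x] sit at the convergents of [x], up to the sign and inversion
    of the piece. *)
Lemma vpt_cvg x s : irrational x -> is_cfrac `|x| (cfrac_terms (piece_of x) s) ->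
  (fun n => vpt R (prefix_way (piece_of x) s n)) @ \oo --> (Some x : RP1 R).
Proof.
move=> ix; rewrite is_cfrac_terms// => sx.
(* The shift drops the empty sequence, whose point may be infinity; all later points are finite. *)
rewrite -cvg_shiftS.
pose v n := let y := convergent R n (fun i => val (s i)) in
  let z := if (piece_of x).2 then y else y^-1 in
  if (piece_of x).1 then - z else z.
have -> : [sequence vpt R (prefix_way (piece_of x) s n.+1)]_n = Some \o v.
  apply/funext => n /=; rewrite /vpt /prefix_way /ratpt mkseqS.
  have [a0 _] := cvec_bounds (rcons (mkseq s n) (s n)).
  have b0 : (cvec (rcons (mkseq s n) (s n))).2 != 0%N.
    by apply/eqP => /cvec2_eq0; case: (mkseq s n).
  rewrite /v convergent_cfv cfv_cvec /vnum /vden; case: (piece_of x) => ng bg /=.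
  by case: bg; case: ng; rewrite /= ?eqz_nat ?(negbTE b0) ?gtn_eqF//
    ?rmorphN /= ?mulNr ?invf_div.
apply: (cvg_comp v Some); last exact: one_point_compactification_some_continuous.
have x0 := irrational_neq0 ix.
have bx : big_part (piece_of x) x != 0.
  by rewrite /big_part; case: ifP; rewrite ?invr_eq0 normr_eq0.
have lim1 : (fun n => let y := convergent R n (fun i => val (s i)) in
    if (piece_of x).2 then y else y^-1) @ \oo --> `|x|.
  move: sx bx; rewrite /big_part /is_cfrac /=; case: ifP => // _ sx bx.
  by rewrite -[`|x|]invrK; exact: cvgV.
rewrite /v /=; have [xn|xp] := ltrP x 0.
  have xE : - `|x| = x by rewrite ltr0_norm// opprK.
  have lim2 := cvgN lim1; rewrite xE in lim2; exact: lim2.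
have xE : `|x| = x by rewrite ger0_norm.
by rewrite xE in lim1; exact: lim1.
Qed.

End Irrationals.

(** * The action on the boundary *)

Lemma finite_nat_bounded (A : set nat) :
  finite_set A -> exists N, forall j, A j -> (j < N)%N.
Proof.
move=> /finite_seqP[s ->]; exists (\max_(i <- s) i).+1 => j /= js.
by rewrite ltnS; exact: (leq_bigmax_seq j js isT).
Qed.

Lemma tail_cvg (T : ptopologicalType) (u v : nat -> T) (l : T) M N :
  (forall j, u (M + j)%N = v (N + j)%N) -> v @ \oo --> l -> u @ \oo --> l.
Proof.
move=> uv vl; rewrite -(cvg_shiftn M) (_ : [sequence _]_n = [sequence v (n + N)%N]_n).
  by rewrite cvg_shiftn.
by apply/funext => n; rewrite /= addnC uv addnC.
Qed.

Section BoundaryAction.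
Variables (R : realType) (c : rel piece).

(** Surjectivity of [Xi], by which [pinv] is a right inverse at every boundary point. *)
Lemma Xi_range (a : way (edge c)) : exists x : irr R, Xi c x = boundary_point a.
Proof.
have [p [s [M [N aE]]]] := way_eventually_prefix a.
have [x [px qx]] := @Xi_surj R c p s.
by exists x; rewrite /Xi px qx; apply/boundary_point_eq; exists N, M => j; rewrite aE.
Qed.

Lemma way_vpt_cvg (a : way (edge c)) (x : irr R) : Xi c x = boundary_point a ->
  (fun j => vpt R (a j)) @ \oo --> (Some (val x) : RP1 R).
Proof.
move=> /boundary_point_eq[M [N aE]].
have ix : irrational (val x) by have := valP x; rewrite inE.
apply: (@tail_cvg _ _ _ _ N M _ (vpt_cvg ix (partial_quotientsP ix))) => j.
by rewrite -aE.
Qed.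

(** A way crosses a broken edge only finitely often, so [g] sends a tail of it to a way [b]. The
    points along [b] converge to the number coded by [b], and by continuity to the image under [f]
    of the number coded by [a]; limits on the circle are unique. *)
Lemma boundary_map_Xi (f : RP1 R -> RP1 R) (kappa : irr R -> irr R)
    (g : vertex -> vertex) :
  continuous f -> induces f kappa -> injective g ->
  (forall v, vpt R (g v) = f (vpt R v)) ->
  finite_set [set vw : vertex * vertex |
    edge c vw.1 vw.2 /\ ~ edge c (g vw.1) (g vw.2)] ->
  boundary_map g (Xi c \o kappa \o pinv setT (Xi c)).
Proof.
move=> fcont fk gI gE bad a.
have [aI aE] := proj2_sig a.
have [N NP] : exists N, forall j, edge c (g (a (j + N)%N)) (g (a (j + N).+1)).
  have [|N NP] := @finite_nat_bounded ((fun j => (a j, a j.+1)) @^-1` 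
    [set vw : vertex * vertex | edge c vw.1 vw.2 /\ ~ edge c (g vw.1) (g vw.2)]).
    by apply: finite_preimage bad => i j _ _ [/aI].
  exists N => j; apply: contrapT => nE.
  by have := NP (j + N)%N (conj (aE _) nE); rewrite ltnNge leq_addl.
have bway : is_way (edge c) (fun j => g (a (j + N)%N)).
  by split=> [i j /gI/aI/addIn//|j]; exact: NP.
pose b : way (edge c) := exist _ _ bway.
exists N, b; split=> //=.
set x := pinv setT (Xi c) (boundary_point a).
have xa : Xi c x = boundary_point a.
  have [y ya] := Xi_range a; rewrite /x pinvK// inE.
  by exists y.
have [y yb] := Xi_range b.
suff -> : kappa x = y by [].
apply: val_inj; apply: Some_inj; rewrite -fk.
have haus : hausdorff_space (RP1 R).
  exact: one_point_compactification_hausdorff (@locally_compactR R) (@Rhausdorff R).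
have lim_b := way_vpt_cvg yb.
have lim_fa : (fun j => vpt R (b j)) @ \oo --> f (Some (val x)).
  apply: (@tail_cvg _ _ (fun j => f (vpt R (a j))) _ 0%N N) => [j|].
    by rewrite -gE add0n addnC.
  by apply: (cvg_comp _ f (way_vpt_cvg xa)); exact: fcont.
exact: (cvg_unique haus lim_fa lim_b).
Qed.

End BoundaryAction.

(* [pinv setT (Xi c)] is the inverse of the bijection [Xi c]. *)
Theorem theorem3p2 (R : realType) (c : rel piece) (hc : connecting_edges c)
    (f : RP1 R -> RP1 R) (hf : Thompson f)
    (kappa : irr R -> irr R) (hkappa : induces f kappa) :
  Hier (Xi c \o kappa \o pinv setT (Xi c)).
Proof.
have [[fcont [f' [fK f'K f'cont]]] [C [Cfin C0 CQ fC]]] := hf.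
have [csym _ _ _] := hc.
have fQ := piecewise_moebius_RP1Q Cfin C0 fC.
have f'C := piecewise_moebius_inv Cfin C0 fC fK f'K.
have C'fin : finite_set (f @` C) by exact: finite_image.
have C'0 : f @` C !=set0 by case: C0 => z Cz; exists (f z), z.
have C'Q : f @` C `<=` @RP1Q R by move=> _ [z /CQ/fQ zQ <-].
have f'Q := piecewise_moebius_RP1Q C'fin C'0 f'C.
(* [f] acts on germs: it moves the point and keeps the side, as its pieces preserve orientation. *)
have /choice[g gE] : forall v, exists w,
    vpt R w = f (vpt R v) /\ side w = side v.
  by move=> v; apply/vpt_surj/fQ/vpt_RP1Q.
have /choice[g' g'E] : forall v, exists w,
    vpt R w = f' (vpt R v) /\ side w = side v.
  by move=> v; apply/vpt_surj/f'Q/vpt_RP1Q.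
have gK : cancel g g'.
  move=> v; apply: (@vpt_inj R).
    by rewrite (g'E _).1 (gE _).1 fK.
  by rewrite (g'E _).2 (gE _).2.
have g'K : cancel g' g.
  move=> v; apply: (@vpt_inj R).
    by rewrite (gE _).1 (g'E _).1 f'K.
  by rewrite (gE _).2 (g'E _).2.
have bad := almost_edge_preserving Cfin C0 CQ fC csym fK gE.
have bad' := almost_edge_preserving C'fin C'0 C'Q f'C csym f'K g'E.
exists g; first exact: almost_automorphism_vertex hc gK g'K bad bad'.
apply: boundary_map_Xi bad => //; first exact: can_inj gK.
by move=> v; have [] := gE v.
Qed.
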